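(* Let $\ell > 0$, $M \geq 0$ and let $Q \subset \mathbb{R}^n$ be a cube of sidelength $\ell$ parallel to the axes. Let $\mu$ be a probability measure supported on $Q$ with density $\exp(-\psi)$ for a convex function $\psi: Q \rightarrow \mathbb{R}$ such that $$ \partial^{ii} \psi(x) \leq M \qquad \text{for all } x \in Q,\ i=1,\ldots,n. $$ Suppose that $A \subseteq \mathbb{R}^n$ is a measurable set with $\mu(A) \geq 1/2$. Then, for all $t > 0$, $$ \mu \left( A + t B^n \right) \geq 1 - \exp \left(- t^2 / \alpha^2 \right), \qquad \text{where } \alpha = \alpha(\ell,M) = 3 \ell e^{M \ell^2/8}. $$
   Context: A cube $Q\subset\mathbb{R}^n$ of sidelength $\ell$ parallel to the axes is a translate of $(0,\ell)^n$ (or, equivalently, of its closure). $\partial^{ii}\psi$ denotes the pure second partial derivative of $\psi$ in the $i$-th coordinate; the hypothesis presupposes that these derivatives exist. $|\cdot|$ is the Euclidean norm, $B^n = \{x \in \mathbb{R}^n : |x| \leq 1\}$, and $A + tB^n = \{x + t y : x \in A,\ y \in B^n\}$. ''Measurable'' means Borel measurable, and densities are with respect to Lebesgue measure. *)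

(* Defs.v *)
From HB Require Import structures.
From mathcomp Require Import all_boot all_order all_algebra.
From mathcomp Require Import all_classical all_reals all_analysis.
From mathcomp Require Import measurable_realfun.

Set Implicit Arguments.
Unset Strict Implicit.
Unset Printing Implicit Defensive.

Import Order.TTheory GRing.Theory Num.Theory.
Import numFieldNormedType.Exports.

Local Open Scope classical_set_scope.
Local Open Scope ring_scope.

Definition borel_rV (R : realType) (n : nat) :=
  g_sigma_algebraType (@open 'rV[R]_n).

Section borel_rV_theory.
Context {R : realType}.

Lemma open_measurable_rV n (U : set 'rV[R]_n) :
  open U -> measurable (U : set (borel_rV R n)).
Proof. by move=> oU; exact: sub_sigma_algebra. Qed.

Lemma measurable_rV_coord n (i : 'I_n) :
  measurable_fun [set: borel_rV R n]
    (fun x : borel_rV R n => (x : 'rV[R]_n) ord0 i : measurableTypeR R).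
Proof.
apply: (measurability _ (RGenOpens.measurableE R)).
move=> _ [_ [a [b ->] <-]]; rewrite setTI; apply: open_measurable_rV.
apply: open_comp; last exact: interval_open.
by move=> x _; exact: coord_continuous.
Qed.

Let rbox n (p : 'rV[rat]_n * nat) : set 'rV[R]_n :=
  [set x | forall i, `|ratr (p.1 ord0 i) - x ord0 i| < p.2.+1%:R^-1].

Let open_rboxE n (U : set 'rV[R]_n) : open U ->
  U = \bigcup_p (if `[< rbox p `<=` U >] then rbox p else set0).
Proof.
move=> oU; apply/seteqP; split => [x Ux|x [p _]]; last first.
  by case: asboolP => // pU /pU.
have /nbhs_ballP[e /= e0 xeU] : nbhs x U by move: oU; rewrite openE; exact.
have e20 : 0 < e / 2 by rewrite divr_gt0.
have [k _ /(_ k (leqnn k)) /= ke] := near_infty_natSinv_lt (PosNum e20).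
have xq i : exists q : rat, `|ratr q - x ord0 i| < k.+1%:R^-1.
  have [|q] := @rat_in_itvoo R (x ord0 i - k.+1%:R^-1) (x ord0 i + k.+1%:R^-1).
    by rewrite ltrD2l gtrN// invr_gt0.
  by rewrite in_itv/= -ltr_distl => ?; exists q.
have [q xqP] := choice xq.
have pU : rbox (\row_i q i, k) `<=` U.
  move=> y /= yq; apply: xeU; split=> // i j; rewrite ord1 /ball /=.
  rewrite -(subrKA (ratr (q j))) (splitr e).
  apply: (le_lt_trans (ler_normD _ _)); apply: ltrD.
    by rewrite distrC; exact: lt_trans (xqP j) ke.
  by have := yq j; rewrite mxE => /lt_trans; exact.
exists (\row_i q i, k) => //; case: asboolP => // _ i /=; rewrite mxE; exact: xqP.
Qed.

Lemma measurable_fun_rVP d (T : measurableType d) n (f : T -> borel_rV R n) :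
  measurable_fun [set: T] f <->
  forall i, measurable_fun [set: T]
    (fun x => (f x : 'rV[R]_n) ord0 i : measurableTypeR R).
Proof.
split=> [mf i|mf]; first exact: measurableT_comp (measurable_rV_coord i) mf.
apply: (@measurability _ _ _ _ _ f (@open 'rV[R]_n)) => //.
move=> _ [U oU <-]; rewrite setTI (open_rboxE oU) preimage_bigcup.
apply: countable_bigcupT_measurable => [|p]; first exact: countableP.
case: asboolP => _; last by rewrite preimage_set0.
have -> : f @^-1` rbox p = \bigcap_(i in [set: 'I_n])
    ((fun x => (f x : 'rV[R]_n) ord0 i : measurableTypeR R) @^-1`
      ball (ratr (p.1 ord0 i) : R) p.2.+1%:R^-1).
  by apply/seteqP; split=> [x /= + i _|x /= + i]; apply.
apply: fin_bigcap_measurable => // i _.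
rewrite -[X in measurable X]setTI; apply: mf => //.
by apply: open_measurable; exact: ball_open.
Qed.

Definition consrV n (p : R * 'rV[R]_n) : 'rV[R]_n.+1 :=
  row_mx (p.1%:M : 'rV[R]_1) p.2.

Lemma consrV0 n (p : R * 'rV[R]_n) : consrV p ord0 ord0 = p.1.
Proof.
have -> : (ord0 : 'I_n.+1) = lshift n (ord0 : 'I_1) by exact: val_inj.
by rewrite [LHS](@row_mxEl R 1 1 n) mxE.
Qed.

Lemma consrVS n (p : R * 'rV[R]_n) i :
  consrV p ord0 (lift ord0 i) = p.2 ord0 i.
Proof.
have -> : lift ord0 i = rshift 1 i by rewrite rshift1.
exact: (@row_mxEr R 1 1 n).
Qed.

Lemma measurable_consrV n :
  measurable_fun [set: measurableTypeR R * borel_rV R n]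
    (@consrV n : _ -> borel_rV R n.+1).
Proof.
apply/measurable_fun_rVP => i.
case: (unliftP ord0 i) => [j ->|->].
- under [X in measurable_fun _ X]eq_fun do rewrite consrVS.
  exact: (measurableT_comp (measurable_rV_coord j) measurable_snd).
- under [X in measurable_fun _ X]eq_fun do rewrite consrV0.
  exact: measurable_fst.
Qed.

Definition unconsrV n (x : 'rV[R]_n.+1) : R * 'rV[R]_n :=
  (x ord0 ord0, \row_i x ord0 (lift ord0 i)).

Lemma consrVK n : cancel (@consrV n) (@unconsrV n).
Proof.
move=> [a x]; rewrite /unconsrV consrV0; congr pair.
by apply/rowP => i; rewrite mxE consrVS.
Qed.

Lemma measurable_unconsrV n :
  measurable_fun [set: borel_rV R n.+1]
    (@unconsrV n : _ -> (measurableTypeR R * borel_rV R n)%type).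
Proof.
apply/measurable_fun_pairP; split; first exact: measurable_rV_coord.
apply/measurable_fun_rVP => i.
under [X in measurable_fun _ X]eq_fun do rewrite mxE.
exact: measurable_rV_coord.
Qed.

End borel_rV_theory.

Section lebesgue_consrV.
Context {R : realType} (n : nat).
Variable m : {sigma_finite_measure set (borel_rV R n) -> \bar R}.
Local Open Scope ereal_scope.

Definition lebesgue_consrV : set (borel_rV R n.+1) -> \bar R :=
  pushforward (@lebesgue_measure R \x m) (@consrV R n : _ -> borel_rV R n.+1).

Let lebesgue_consrV0 : lebesgue_consrV set0 = 0.
Proof. by rewrite /lebesgue_consrV /pushforward preimage_set0 measure0. Qed.

Let lebesgue_consrV_ge0 A : 0 <= lebesgue_consrV A.
Proof. by apply: measure_ge0; exact: measurable_consrV. Qed.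

Let lebesgue_consrV_sigma_additive : semi_sigma_additive lebesgue_consrV.
Proof.
by apply: measure_semi_sigma_additive; exact: measurable_consrV.
Qed.

HB.instance Definition _ := isMeasure.Build _ _ _ lebesgue_consrV
  lebesgue_consrV0 lebesgue_consrV_ge0 lebesgue_consrV_sigma_additive.

Let lebesgue_consrV_sigma_finite : sigma_finite setT lebesgue_consrV.
Proof.
have /sigma_finiteP[F [FT ndF Foo]] := sigma_finiteT (@lebesgue_measure R).
have /sigma_finiteP[G [GT ndG Goo]] := sigma_finiteT m.
exists (fun k => @unconsrV R n @^-1` (F k `*` G k)).
  apply/seteqP; split=> // x _.
  have [i _ Fi] : (\bigcup_i F i) (unconsrV x).1 by rewrite -FT.
  have [j _ Gj] : (\bigcup_i G i) (unconsrV x).2 by rewrite -GT.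
  exists (maxn i j) => //; split.
    by move: Fi; apply/subsetPset/ndF; exact: leq_maxl.
  by move: Gj; apply/subsetPset/ndG; exact: leq_maxr.
move=> k; have [mF Fk] := Foo k; have [mG Gk] := Goo k; split.
  rewrite -[X in measurable X]setTI; apply: measurable_unconsrV => //.
  exact: measurableX.
rewrite /lebesgue_consrV /pushforward -comp_preimage.
rewrite (_ : _ \o _ = id) ?preimage_id; last first.
  by apply/funext => p; exact: consrVK.
by rewrite product_measure1E// lte_mul_pinfty// ge0_fin_numE.
Qed.

HB.instance Definition _ := Measure_isSigmaFinite.Build _ _ _ lebesgue_consrV
  lebesgue_consrV_sigma_finite.

End lebesgue_consrV.

(* Iterated product of the one-dimensional Lebesgue measure; by                 *)
(* [lebesgue_rV_open_box] it gives boxes their usual volume.                    *)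
Fixpoint lebesgue_rV (R : realType) (n : nat) :
    {sigma_finite_measure set (borel_rV R n) -> \bar R} :=
  match n with
  | 0 => @dirac _ (borel_rV R 0) (0 : 'rV[R]_0) R
  | n'.+1 => lebesgue_consrV (lebesgue_rV R n')
  end.

Definition open_box (R : realType) n (a b : 'rV[R]_n) : set (borel_rV R n) :=
  [set x | forall i, a ord0 i < (x : 'rV[R]_n) ord0 i < b ord0 i].

Lemma measurable_open_box (R : realType) n (a b : 'rV[R]_n) :
  measurable (open_box a b).
Proof.
have -> : open_box a b = \bigcap_(i in [set: 'I_n])
    ((fun x : borel_rV R n => (x : 'rV[R]_n) ord0 i : measurableTypeR R) @^-1`
      `]a ord0 i, b ord0 i[%classic).
  apply/seteqP; split=> [x /= + i _|x /= + i]; rewrite ?in_itv; first exact.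
  by move/(_ i Logic.I); rewrite /= in_itv.
apply: fin_bigcap_measurable => // i _.
by rewrite -[X in measurable X]setTI; exact: measurable_rV_coord.
Qed.

Lemma lebesgue_rV_open_box (R : realType) n (a b : 'rV[R]_n) :
  (forall i, a ord0 i <= b ord0 i) ->
  lebesgue_rV R n (open_box a b) = (\prod_i (b ord0 i - a ord0 i))%:E.
Proof.
elim: n => [|n IH] in a b * => ab /=.
  by rewrite big_ord0 diracE mem_set// => -[].
rewrite /lebesgue_consrV /pushforward.
pose a' := (unconsrV a).2; pose b' := (unconsrV b).2.
have -> : (@consrV R n : _ -> borel_rV R n.+1) @^-1` open_box a b =
    `]a ord0 ord0, b ord0 ord0[%classic `*` open_box a' b'.
  apply/seteqP; split=> [p /= abp|p /= [ab0 abS] i].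
    split; first by have := abp ord0; rewrite consrV0 in_itv.
    by move=> i; have := abp (lift ord0 i); rewrite consrVS !mxE.
  case: (unliftP ord0 i) => [j ->|->].
    by have := abS j; rewrite consrVS !mxE.
  by rewrite consrV0; move: ab0; rewrite in_itv.
rewrite product_measure1E//; last exact: measurable_open_box.
rewrite IH; last by move=> i; rewrite !mxE.
rewrite big_ord_recl EFinM; congr (_ * _)%E; last first.
  by congr EFin; apply: eq_bigr => i _; rewrite !mxE.
apply: etrans (lebesgue_measure_itv _) _; rewrite /= lte_fin -EFinB.
by have := ab ord0; rewrite le_eqVlt => /predU1P[->|->//]; rewrite ltxx subrr.
Qed.

Definition cube (R : realType) n (a : 'rV[R]_n) (l : R) : set (borel_rV R n) :=
  open_box a (a + const_mx l).

(* The library norm on ['rV[R]_n] is the sup norm. *)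
Definition euclid_norm (R : realType) n (x : 'rV[R]_n) : R :=
  Num.sqrt (\sum_i x ord0 i ^+ 2).

Definition euclid_ball (R : realType) n : set 'rV[R]_n :=
  [set x | euclid_norm x <= 1].

Definition thickening (R : realType) n (A : set 'rV[R]_n) (t : R) :
    set 'rV[R]_n :=
  [set x + t *: y | x in A & y in @euclid_ball R n].

(* A + tB need not be Borel when A is (B is the closed ball), and a measure on  *)
(* the Borel sets has unspecified values elsewhere. The mass of such a set is   *)
(* the one given by the completion of the measure; [inner_measure] computes it, *)
(* see [inner_measure_completion] and [inner_measureE].                         *)
Definition inner_measure d (T : measurableType d) (R : realType)
    (mu : set T -> \bar R) (B : set T) : \bar R :=
  ereal_sup [set mu E | E in [set E | measurable E /\ E `<=` B]].

Section inner_measure_theory.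
Context d (T : measurableType d) (R : realType).
Variable mu : {measure set T -> \bar R}.

Lemma inner_measure_completion (E B : set T) :
  measurable E -> E `<=` B -> mu.-negligible (B `\` E) ->
  inner_measure mu B = mu E.
Proof.
move=> mE EB [N [mN N0 BEN]]; apply/eqP; rewrite eq_le; apply/andP; split.
  apply: ge_ereal_sup => _ [F [mF FB] <-].
  have FEN : F `<=` E `|` N.
    move=> x Fx; have [Ex|nEx] := pselect (E x); [by left|right].
    by apply: BEN; split=> //; exact: FB.
  apply: (@le_trans _ _ (mu (E `|` N))).
    by apply: le_measure => //; rewrite inE//; exact: measurableU.
  by rewrite -[leRHS]adde0 -[X in (_ + X)%E]N0; exact: measureU2.
by apply: ereal_sup_ubound; exists E.
Qed.

Lemma inner_measureE (B : set T) : measurable B -> inner_measure mu B = mu B.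
Proof.
move=> mB; apply: inner_measure_completion => //.
by rewrite setDv; exact: negligible_set0.
Qed.

End inner_measure_theory.

Definition alpha (R : realType) (l M : R) : R := 3 * l * expR (M * l ^+ 2 / 8).

(* Main.v *)
Require Import Defs.
From HB Require Import structures.
From mathcomp Require Import all_boot all_order all_algebra.
From mathcomp Require Import all_classical all_reals all_analysis.
From mathcomp Require Import measurable_realfun ring lra.

Import Order.TTheory GRing.Theory Num.Theory.
Import numFieldNormedType.Exports.

Local Open Scope classical_set_scope.
Local Open Scope ring_scope.

(** Fix a subset [A] and let [T] be the Knothe map pushing [mu] forward to the
    probability [nu] with density proportional to [expR (- C * d(., A)^2)] with
    respect to [mu]. Write [T x = x + S x]. The change of variables formula, the
    convexity of [psi] and an integration by parts in each coordinate ([S_i]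
    vanishes on the two faces orthogonal to [e_i]) bound the relative entropy of
    [nu] from below by the [mu]-integral of [\sum_i (t_i - 1 - ln t_i)], where
    [t_i = 1 + d_i S_i]. A one-dimensional inequality bounds this from below by
    [c] times the [mu]-integral of [|S|^2], where [c = 1 / (2 l^2 kap)] and
    [kap = expR (M l^2 / 8)] measures how far [psi] is from affine on lines
    parallel to the axes. This gives
    [ln (mu A) <= - (8 c / 9) * \int d(x, A)^2 dmu(x)].
    Adding the inequality for [B], the complement of the [t]-thickening of [A],
    and using [d(x, A)^2 + d(x, B)^2 >= t^2 / 2], one gets
    [mu A * mu B <= expR (- 4 c t^2 / 9)], and [mu B <= 1 / 2 <= mu A] turns this
    into the claim. Since the Knothe map is triangular, the entropy inequality is
    proved by induction on the dimension, slice by slice, so that only monotone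
    maps of the line are ever constructed. *)

(** * Integrals of continuous functions over a segment *)

Section integral_of_continuous.
Context {R : realType}.
Implicit Types (f g : R -> R) (a b : R).

(** This is not the oriented integral: for [b < a] the segment is empty and the value is 0, whence
    the order hypotheses in the lemmas that follow. *)
Definition itg a b f : R := \int[lebesgue_measure]_(x in `[a, b]) f x.

Lemma itg_integrable a b f : continuous f ->
  (@lebesgue_measure R).-integrable `[a, b] (EFin \o f).
Proof.
move=> cf; apply: continuous_compact_integrable; first exact: segment_compact.
exact: continuous_subspaceT.
Qed.

Lemma eq_itg a b f g : (forall x, a <= x <= b -> f x = g x) ->
  itg a b f = itg a b g.
Proof.
by move=> fg; apply: eq_Rintegral => x; rewrite inE/= in_itv/= => /fg.
Qed.

Lemma itgD a b f g : continuous f -> continuous g ->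
  itg a b (fun x => f x + g x) = itg a b f + itg a b g.
Proof. by move=> cf cg; apply: RintegralD => //; exact: itg_integrable. Qed.

Lemma itgB a b f g : continuous f -> continuous g ->
  itg a b (fun x => f x - g x) = itg a b f - itg a b g.
Proof. by move=> cf cg; apply: RintegralB => //; exact: itg_integrable. Qed.

Lemma itgZ a b c f : continuous f ->
  itg a b (fun x => c * f x) = c * itg a b f.
Proof. by move=> cf; apply: RintegralZl => //; exact: itg_integrable. Qed.

Lemma itg_cst a b c : a <= b -> itg a b (fun=> c) = c * (b - a).
Proof.
move=> ab; rewrite /itg Rintegral_cst//.
congr (_ * _).
apply: etrans (congr1 fine (lebesgue_measure_itv `[a, b])) _; rewrite /= lte_fin.
by move: ab; rewrite le_eqVlt => /predU1P[->|->//]; rewrite ltxx subrr.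
Qed.

Lemma le_itg a b f g : continuous f -> continuous g ->
  (forall x, a <= x <= b -> f x <= g x) -> itg a b f <= itg a b g.
Proof.
by move=> cf cg fg; apply: le_Rintegral => //; exact: itg_integrable.
Qed.

Lemma itg_ge0 a b f : (forall x, a <= x <= b -> 0 <= f x) -> 0 <= itg a b f.
Proof. by move=> f0; apply: Rintegral_ge0 => x /=; rewrite in_itv/= => /f0. Qed.

Lemma itg_xx a f : itg a a f = 0.
Proof. by rewrite /itg set_itv1 Rintegral_set1. Qed.

Lemma itg_cat a c b f : continuous f -> a <= c -> c <= b ->
  itg a b f = itg a c f + itg c b f.
Proof.
move=> cf ac cb; apply/eqP; rewrite addrC -subr_eq; apply/eqP.
have /= -> := @Rintegral_itvB R f (BLeft a) (BRight b) c (itg_integrable a b f cf) _ _.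
- rewrite Rintegral_itv_obnd_cbnd//.
  by apply: integrableS (itg_integrable c b f cf) => //; exact: subset_itv_oc_cc.
- by rewrite bnd_simp.
- by rewrite bnd_simp.
Qed.

Lemma itg_FTC2 a b F f : a <= b -> continuous f -> continuous F ->
  (forall x, a < x < b -> is_derive x 1 F (f x)) -> itg a b f = F b - F a.
Proof.
rewrite le_eqVlt => /predU1P[->|ab] cf cF dF; first by rewrite itg_xx subrr.
rewrite /itg /Rintegral (@continuous_FTC2 _ f F a b)//.
- exact: continuous_subspaceT.
- split.
  + by move=> x; rewrite in_itv/= => /dF[].
  + exact/cvg_at_right_filter/cF.
  + exact/cvg_at_left_filter/cF.
- by move=> x; rewrite in_itv/= => /dF; rewrite derive1E => -[].
Qed.

(** Strictness of [a < x] matters: to the left of [a] the integral is constantly 0, so at [a] only a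
    one-sided derivative can be expected. *)
Lemma itg_FTC1 a x f : a < x -> continuous f ->
  is_derive x 1 (itg a ^~ f) (f x).
Proof.
move=> ax cf; have xx1 : x < x + 1 by rewrite ltrDl.
have [dF F'] := @continuous_FTC1_closed R f a x (x + 1) xx1
  (itg_integrable a (x + 1) f cf) ax (cf x).
by apply: DeriveDef; [exact: dF|rewrite -derive1E F'].
Qed.

Lemma itg_gt0 a b f : a < b -> continuous f ->
  (forall x, a <= x <= b -> 0 < f x) -> 0 < itg a b f.
Proof.
move=> ab cf f0.
have [c cab fc] := @EVT_min R f a b (ltW ab) (continuous_subspaceT cf).
have {}cab : a <= c <= b by move: cab; rewrite in_itv.
apply: (@lt_le_trans _ _ (itg a b (fun=> f c))).
  by rewrite itg_cst ?ltW// mulr_gt0 ?subr_gt0 ?f0.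
apply: le_itg => //; first exact: cst_continuous.
Qed.

End integral_of_continuous.

Section clamp.
Context {R : realType}.

(** For [a <= b], the retraction of the line onto [[a, b]]. Composing with it makes a function
    continuous everywhere without changing it on the segment. *)
Definition clamp (a b x : R) : R := Num.max a (Num.min b x).

Lemma clamp_continuous a b : continuous (clamp a b).
Proof.
move=> x; apply: (@continuous_max R R (cst a) (fun x => Num.min b x)).
  exact: cst_continuous.
by apply: (@continuous_min R R (cst b) id); [exact: cst_continuous|exact: cvg_id].
Qed.

Lemma clamp_id a b x : a <= x <= b -> clamp a b x = x.
Proof. by move=> /andP[ax xb]; rewrite /clamp (min_idPr xb) (max_idPr ax). Qed.

Lemma clamp_itv a b x : a <= b -> a <= clamp a b x <= b.
Proof.
by move=> ab; rewrite /clamp le_max lexx ge_max ab ge_min lexx.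
Qed.

End clamp.

(** One rule for all affine changes of variable or value; later terms such as [0 + q * (h - 0)] keep
    their trivial constants to match this shape. *)
Lemma is_derive_affine (R : realType) (f : R -> R) (p q s x d : R) :
  is_derive x 1 f d -> is_derive x 1 (fun y => p + q * (f y - s)) (q * d).
Proof.
move=> df.
have h : is_derive x 1 (cst p + q *: (f - cst s)) (0 + q *: (d - 0)).
  exact: is_deriveD.
by apply: is_derive_eq; rewrite add0r subr0.
Qed.

(** * Monotone transport between two positive densities on a segment *)

Section monotone_transport.
Context {R : realType}.
Implicit Types (f : R -> R) (a b : R).

Lemma inverse_itg a b f : a < b -> continuous f -> (forall x, 0 < f x) ->
  let L := itg a ^~ f in
  exists g : R -> R, forall y, a < y < b ->
    is_derive (L y) 1 g (f y)^-1 /\ g (L y) = y.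
Proof.
move=> ab cf f0 L.
have Llt x y : a <= x -> x < y -> L x < L y.
  move=> ax xy; rewrite /L (itg_cat a x y)// ?(ltW xy)// ltrDl.
  by apply: itg_gt0.
(* The implication lets the choice range over all [v]; outside the image of [[a, b]] under [L] the
   value of [g] is irrelevant. *)
have /choice[g gP] : forall v, exists y, (exists2 z, a <= z <= b & L z = v) ->
    a <= y <= b /\ L y = v.
  move=> v; have [[z zab Lz]|nz] := pselect (exists2 z, a <= z <= b & L z = v).
    by exists z.
  by exists 0.
have gK z : a <= z <= b -> g (L z) = z.
  move=> zab; have [|/andP[a1 b1] LgL] := gP (L z); first by exists z.
  case/andP: zab => a2 b2; case: (ltgtP (g (L z)) z) => // lt.
    by have := Llt _ _ a1 lt; rewrite LgL ltxx.
  by have := Llt _ _ a2 lt; rewrite LgL ltxx.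
exists g => y yab; split.
  2: by apply: gK; case/andP: yab => /ltW-> /ltW.
have yab' : y \in `]a, b[ by rewrite in_itv.
apply: is_derive_inverse.
- near=> z; apply: gK.
  suff: z \in `]a, b[ by rewrite in_itv/= => /andP[/ltW -> /ltW].
  by near: z; exact: near_in_itvoo.
- near=> z; suff: z \in `]a, b[.
    rewrite in_itv/= => /andP[az zb].
    have [dL _] := itg_FTC1 a z f az cf.
    by apply: differentiable_continuous; exact/derivable1_diffP.
  by near: z; exact: near_in_itvoo.
- by apply: itg_FTC1 => //; case/andP: yab.
- by rewrite gt_eqF.
Unshelve. all: by end_near. Qed.

(** [T x] is the point to the left of which [w] has the same fraction of its mass as [r] has to the
    left of [x]. It is the inverse of the cumulative integral of [w] after a rescaled cumulative
    integral of [r], and the chain rule gives its derivative. *)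
Lemma monotone_transport a b (r w : R -> R) : a < b ->
  continuous r -> continuous w -> (forall x, 0 < r x) -> (forall x, 0 < w x) ->
  exists T : R -> R, [/\ continuous T, T a = a, T b = b,
    forall x, a <= T x <= b &
    forall x, a < x < b ->
      is_derive x 1 T ((r x / itg a b r) / (w (T x) / itg a b w))].
Proof.
move=> ab cr cw r0 w0.
set Z := itg a b r; set W := itg a b w.
have Z0 : 0 < Z by apply: itg_gt0.
have W0 : 0 < W by apply: itg_gt0.
(* Starting the cumulative integrals at [a'] and inverting on the larger segment makes [a] and [b]
   interior points, so that derivatives exist there too. *)
pose a' := a - 1; pose b' := b + 1.
have a'a : a' < a by rewrite /a' gtrBl.
have bb' : b < b' by rewrite /b' ltrDl.
have a'b' : a' < b' by rewrite (lt_trans a'a)// (lt_trans ab).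
have [g gP] := inverse_itg a' b' w a'b' cw w0.
pose L := itg a' ^~ w.
pose F x := L a + W / Z * (itg a' x r - itg a' a r).
have LF x : a <= x <= b -> exists2 y, a <= y <= b & L y = F x.
  move=> /andP[ax xb].
  have LaFa : F a = L a by rewrite /F subrr mulr0 addr0.
  have LbFb : F b = L b.
    rewrite /F /L (itg_cat a' a b w)// ?ltW//; congr (_ + _).
    by rewrite (itg_cat a' a b r)// ?ltW// addrC addKr -/Z divfK ?gt_eqF.
  have Fx : L a <= F x <= L b.
    rewrite -LaFa -LbFb /F !lerD2l !ler_pM2l ?divr_gt0//.
    rewrite !lerD2r; apply/andP; split.
      rewrite (itg_cat a' a x)// ?(ltW a'a)// lerDl.
      by apply: itg_ge0 => z _; exact: ltW.
    rewrite (itg_cat a' x b)// ?(le_trans (ltW a'a))// lerDl.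
    by apply: itg_ge0 => z _; exact: ltW.
  have cL : {within `[a, b], continuous L}.
    apply: derivable_within_continuous => z; rewrite in_itv/= => /andP[az zb].
    by have [] := itg_FTC1 a' z w (lt_le_trans a'a az) cw.
  have [|y + Ly] := IVT (v := F x) (ltW ab) cL.
    have Lab : L a <= L b by case/andP: Fx; exact: le_trans.
    by rewrite (min_idPl Lab) (max_idPr Lab).
  by rewrite in_itv/= => yab; exists y.
pose T0 x := g (F x).
have T0P x : a <= x <= b -> a <= T0 x <= b /\ L (T0 x) = F x.
  move=> xab; have [y /andP[ay yb] Ly] := LF x xab.
  have yab' : a' < y < b' by rewrite (lt_le_trans a'a)//= (le_lt_trans yb).
  by rewrite /T0 -Ly (gP _ yab').2 ay yb.
have dT0 x : a <= x <= b ->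
    is_derive x 1 T0 ((r x / Z) / (w (T0 x) / W)).
  move=> xab; have [/andP[aT Tb] LT] := T0P x xab.
  have Tab' : a' < T0 x < b' by rewrite (lt_le_trans a'a)//= (le_lt_trans Tb).
  have [dg _] := gP _ Tab'; rewrite -/(L _) LT in dg.
  have ax : a' < x by case/andP: xab => ax _; exact: lt_le_trans ax.
  have dr := itg_FTC1 a' x r ax cr.
  have dF : is_derive x 1 F (W / Z * r x).
    exact: is_derive_affine.
  have -> : r x / Z / (w (T0 x) / W) = (w (T0 x))^-1 * (W / Z * r x).
    by field; rewrite !gt_eqF.
  exact: is_derive1_comp dg dF.
(* [T0] is differentiable, hence continuous, at every point of [[a, b]]; clamping extends this
   continuity to the whole line. *)
exists (T0 \o clamp a b); split.
- move=> x; apply: continuous_comp; first exact: clamp_continuous.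
  apply: differentiable_continuous; apply/derivable1_diffP.
  by have [] := dT0 _ (clamp_itv a b x (ltW ab)).
- rewrite /= clamp_id ?lexx ?ltW// /T0 /F subrr mulr0 addr0.
  by have [|_ ->//] := gP a; rewrite a'a (lt_trans ab).
- rewrite /= clamp_id ?lexx ?ltW// /T0 /F.
  rewrite (itg_cat a' a b r)// ?ltW// [_ + itg a b r]addrC addrK -/Z divfK ?gt_eqF//.
  rewrite /L -itg_cat// ?ltW//.
  by have [|_ ->//] := gP b; rewrite bb' (lt_trans a'a).
- by move=> x; have [] := T0P _ (clamp_itv a b x (ltW ab)).
- move=> x xab; have xab' : a <= x <= b by case/andP: xab => /ltW-> /ltW.
  rewrite /= clamp_id//.
  have := dT0 _ xab'; rewrite -/Z -/W => dx.
  apply: near_eq_is_derive dx.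
  near=> y; rewrite /= clamp_id//.
  suff: y \in `]a, b[ by rewrite in_itv/= => /andP[/ltW-> /ltW].
  by near: y; apply: near_in_itvoo; rewrite in_itv.
Unshelve. all: by end_near. Qed.

End monotone_transport.
(* The right-hand side is [(t - 1) - 3 (t - 1)^2 / (2 + 4 t)]; its difference
   with [ln t] has derivative [(t - 1)^3 / (t (1 + 2 t)^2)]. *)
Lemma ln_le_rational (R : realType) (t : R) : 0 < t ->
  ln t <= t / 4 + 7 / 8 - 27 / 8 / (1 + 2 * t).
Proof.
move=> t0; rewrite -subr_ge0.
pose f (x : R) := x / 4 + 7 / 8 - 27 / 8 / (1 + 2 * x) - ln x.
pose df (x : R) := (x - 1) ^+ 3 / (x * (1 + 2 * x) ^+ 2).
have dfP (x : R) : 0 < x -> is_derive x 1 f (df x).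
  move=> x0; have x1 : 1 + 2 * x != 0 by rewrite gt_eqF// addr_gt0// mulr_gt0.
  have h1 : is_derive x 1 (fun y : R => (1 + 2 * (y - 0))) (2 * 1).
    exact: is_derive_affine.
  have h2 : is_derive x 1 (fun y : R => (1 + 2 * (y - 0))^-1)
      (- (1 + 2 * (x - 0)) ^- 2 *: (2 * 1)).
    by apply: is_deriveV; rewrite subr0.
  have h3 := is_derive1_ln x0.
  have h4 : is_derive x 1 (4^-1 *: (id : R -> R) +
      (- (27 / 8)) *: (fun y : R => (1 + 2 * (y - 0))^-1) - @ln R)
      (4^-1 *: 1 + (- (27 / 8)) *: (- (1 + 2 * (x - 0)) ^- 2 *: (2 * 1)) - x^-1).
    have ha : is_derive x 1 (4^-1 *: (id : R -> R)) (4^-1 *: 1).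
      exact: is_deriveZ.
    have hb : is_derive x 1 (- (27 / 8) *: (fun y : R => (1 + 2 * (y - 0))^-1))
      (- (27 / 8) *: (- (1 + 2 * (x - 0)) ^- 2 *: (2 * 1))) by exact: is_deriveZ.
    have hc := is_deriveD ha hb.
    exact: (is_deriveB hc h3).
  have -> : df x = 1 * (4^-1 *: (1 : R) +
      (- (27 / 8)) *: (- (1 + 2 * (x - 0)) ^- 2 *: (2 * 1 : R)) - x^-1).
    by rewrite /df /GRing.scale/= subr0; field; rewrite x1 gt_eqF.
  have := is_derive_affine _ _ (7 / 8) 1 0 _ _ h4.
  apply: near_eq_is_derive; near=> y; rewrite /f /= !fctE /GRing.scale/= !subr0.
  by ring.
have f1 : f 1 = 0 by rewrite /f ln1; field.
have cf (x y : R) : 0 < x -> {within `[x, y], continuous f}.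
  move=> x0; apply: derivable_within_continuous => z; rewrite in_itv/= => /andP[xz _].
  by have [] := dfP _ (lt_le_trans x0 xz).
have fE : f t = t / 4 + 7 / 8 - 27 / 8 / (1 + 2 * t) - ln t by [].
(* The sign of [df] is that of [x - 1], so [f] is least at 1, where it vanishes. *)
rewrite -fE; have [t1|t1|->] := ltgtP t 1; last by rewrite f1.
- have [||z] := @MVT R f df t 1 t1; last 1 first.
  + rewrite in_itv/= f1 sub0r => /andP[tz z1] E.
    have z0 : 0 < z by exact: lt_trans tz.
    rewrite -oppr_le0 E pmulr_lle0 ?subr_gt0// /df pmulr_lle0.
      rewrite exprS mulr_le0_ge0 ?sqr_ge0// subr_le0 ltW//.
    by rewrite invr_gt0 mulr_gt0// exprn_gt0// addr_gt0// mulr_gt0.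
  + by move=> x; rewrite in_itv/= => /andP[tx _]; apply: dfP; exact: lt_trans tx.
  + exact: cf.
- have [||z] := @MVT R f df 1 t t1; last 1 first.
  + rewrite in_itv/= f1 subr0 => /andP[z1 zt] ->.
    have z0 : 0 < z by exact: lt_trans z1.
    rewrite mulr_ge0 ?subr_ge0 ?(ltW t1)// /df divr_ge0//.
      by rewrite exprn_ge0// subr_ge0 ltW.
    by rewrite mulr_ge0 ?(ltW z0)// exprn_ge0// addr_ge0// mulr_ge0// ltW.
  + by move=> x; rewrite in_itv/= => /andP[tx _]; apply: dfP; exact: lt_trans tx.
  + exact: cf.
Unshelve. all: by end_near. Qed.

(* Replacing the quadratic term of [ln_le_rational] by its tangent in the
   parameter [l] makes it affine in [t], hence integrable along a transport. *)
Lemma ln_le_tangent (R : realType) (l t : R) : 0 < t ->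
  2 * l * (t - 1) - l ^+ 2 * (2 / 3 + 4 / 3 * t) <= t - 1 - ln t.
Proof.
move=> t0; have := ln_le_rational R t t0.
have u0 : 0 < 1 + 2 * t by rewrite addr_gt0// mulr_gt0.
suff : 2 * l * (t - 1) - l ^+ 2 * (2 / 3 + 4 / 3 * t) <=
    t - 1 - (t / 4 + 7 / 8 - 27 / 8 / (1 + 2 * t)) by lra.
rewrite -subr_ge0.
rewrite [leRHS](_ : _ =
  (3 * (t - 1) - 2 * l * (1 + 2 * t)) ^+ 2 / (6 * (1 + 2 * t))).
  by rewrite divr_ge0 ?sqr_ge0// mulr_ge0// ltW.
by field; rewrite gt_eqF.
Qed.

(** * The transport-entropy inequality on a segment *)

Section transport_inequality_1d.
Context {R : realType}.

(** With a constant parameter [lam], the tangent bound on the integrand is affine in [t], so its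
    integral involves only [D] and [d - c]. As both are at most [l], the coefficient of [- lam ^+ 2]
    is at most [2 * l]; the chosen [lam] maximises [2 * lam * (D - (d - c)) - 2 * l * lam ^+ 2]. *)
Lemma itg_bregman_ge (c d l : R) (t : R -> R) : c <= d -> 0 < l ->
  continuous t -> (forall x, 0 < t x) ->
  d - c <= l -> itg c d t <= l ->
  (itg c d t - (d - c)) ^+ 2 / (2 * l) <= itg c d (fun x => t x - 1 - ln (t x)).
Proof.
move=> cd l0 ct t0 dcl tl.
set D := itg c d t; pose lam := (D - (d - c)) / (2 * l).
have clnt : continuous (fun x => ln (t x)).
  by move=> x; apply: continuous_comp; [exact: ct|exact: continuous_ln].
have cu : continuous (fun x => t x - 1 - ln (t x)).
  move=> x; apply: cvgB; last exact: clnt.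
  by apply: cvgB; [exact: ct|exact: cvg_cst].
have ckt k : continuous (fun x => k * t x).
  by move=> x; apply: cvgM; [exact: cvg_cst|exact: ct].
have : itg c d (fun x => (2 * lam - lam ^+ 2 * (4 / 3)) * t x -
    (2 * lam + lam ^+ 2 * (2 / 3))) <=
    itg c d (fun x => t x - 1 - ln (t x)).
  apply: le_itg => //.
    by move=> x; apply: cvgB; [exact: ckt|exact: cvg_cst].
  by move=> x _; have := ln_le_tangent R lam (t x) (t0 x); lra.
set U := itg c d (fun x => t x - 1 - _).
rewrite itgB//; last exact: cst_continuous.
rewrite itgZ// itg_cst// -/D; apply: le_trans.
have DE : D - (d - c) = 2 * l * lam.
  by rewrite /lam; field; rewrite gt_eqF.
have -> : (D - (d - c)) ^+ 2 / (2 * l) = 2 * l * lam ^+ 2.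
  by rewrite DE; field; rewrite gt_eqF.
rewrite -subr_ge0 [leRHS](_ : _ =
    lam ^+ 2 * (2 * l - 4 / 3 * D - 2 / 3 * (d - c)) +
    2 * lam * (D - (d - c) - 2 * l * lam)); last by field.
rewrite DE subrr mulr0 addr0 mulr_ge0 ?sqr_ge0//.
by move: tl dcl; rewrite -/D; lra.
Qed.

(* [P] is the derivative of [r]. The bound of [r x] by [r s1 + r s2] holds with
   [kap = 1] for monotone [r]; unlike a bound by the maximum, it passes to
   marginals. The last hypothesis is the constraint [k(y) - g(x) <= c (x - y)^2] on
   dual potentials, where [w = expR k * r] and [m = g * r], with [ln (r y)]
   replaced by its linearisation at [x] and everything multiplied by [r x], so
   that it survives integration over the other coordinates. *)
Lemma transport_inequality_1d (a b kap c : R) (r P w m : R -> R) :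
  a < b -> continuous r -> continuous P -> continuous w -> continuous m ->
  (forall x, 0 < r x) -> (forall x, 0 < w x) ->
  (forall x, a < x < b -> is_derive x 1 r (P x)) ->
  (forall s1 x s2, a <= s1 -> s1 <= x -> x <= s2 -> s2 <= b ->
    r x <= kap * (r s1 + r s2)) ->
  0 <= kap -> 0 <= c -> 2 * c * kap * (b - a) ^+ 2 <= 1 ->
  (forall x y, a <= x <= b -> a <= y <= b ->
    r x * (ln (w y) - ln (r x)) - P x * (y - x) - c * r x * (x - y) ^+ 2
      <= m x) ->
  itg a b r * (ln (itg a b w) - ln (itg a b r)) <= itg a b m.
Proof.
move=> ab cr cP cw cm r0 w0 dr rP kap0 c0 ckap H.
have [T [cT Ta Tb Tab dT]] := monotone_transport a b r w ab cr cw r0 w0.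
set Z := itg a b r in dT *; set W := itg a b w in dT *.
have Z0 : 0 < Z by apply: itg_gt0.
have W0 : 0 < W by apply: itg_gt0.
have l0 : 0 < b - a by rewrite subr_gt0.
pose t x := r x / Z / (w (T x) / W).
have t0 x : 0 < t x by rewrite !divr_gt0.
have ct : continuous t.
  move=> x; apply: cvgM.
    by apply: cvgM; [exact: cr|exact: cvg_cst].
  apply: cvgV; first by rewrite gt_eqF// divr_gt0.
  apply: cvgM; last exact: cvg_cst.
  by apply: (continuous_comp (cT x)); exact: cw.
have clnt : continuous (fun x => ln (t x)).
  by move=> x; apply: continuous_comp; [exact: ct|exact: continuous_ln].
pose u x := t x - 1 - ln (t x).
have cu : continuous u.
  move=> x; apply: cvgB; last exact: clnt.
  by apply: cvgB; [exact: ct|exact: cvg_cst].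
have u0 x : 0 <= u x by have := ln_le_tangent R 0 (t x) (t0 x); rewrite /u; lra.
pose g x := T x - x.
have cg : continuous g by move=> x; apply: cvgB; [exact: cT|exact: cvg_id].
have dg x : a < x < b -> is_derive x 1 g (t x - 1).
  by move=> xab; exact: (is_deriveB (dT x xab) (is_derive_id x 1)).
have crg : continuous (fun x => r x * g x ^+ 2).
  move=> x; apply: cvgM; first exact: cr.
  by rewrite expr2; apply: cvgM; exact: cg.
have cru : continuous (fun x => r x * u x).
  by move=> x; apply: cvgM; [exact: cr|exact: cu].
set U := itg a b (fun x => r x * u x).
(* As [T] fixes both ends, the displacement [g x] is the integral of [t - 1] over [[a, x]] and minus
   its integral over [[x, b]]. Each side thus bounds [g x ^+ 2] by an integral of [u]. *)
have gU x : a <= x <= b -> r x * g x ^+ 2 <= 2 * (b - a) * kap * U.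
  move=> /andP[ax xb]; have /andP[aT Tb'] := Tab x.
  have tax : itg a x t = T x - a.
    rewrite -[in RHS]Ta; apply: itg_FTC2 => // y /andP[ay yx]; apply: dT.
    by rewrite ay (lt_le_trans yx).
  have txb : itg x b t = b - T x.
    rewrite -[in RHS]Tb; apply: itg_FTC2 => // y /andP[xy yb]; apply: dT.
    by rewrite yb andbT (le_lt_trans ax).
  have gE : g x = T x - x by [].
  have u1 : g x ^+ 2 / (2 * (b - a)) <= itg a x u.
    rewrite (_ : g x = itg a x t - (x - a)); last by rewrite tax gE; ring.
    by apply: itg_bregman_ge; rewrite // ?tax lerD2r.
  have u2 : g x ^+ 2 / (2 * (b - a)) <= itg x b u.
    rewrite -sqrrN (_ : - g x = itg x b t - (b - x)); last by rewrite txb gE; ring.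
    by apply: itg_bregman_ge; rewrite // ?txb lerD2l lerN2.
  (* On each side of [x] the weighted integral of [u] dominates the minimum of [r]
     there times the unweighted one, which is at least [g x ^+ 2 / (2 (b - a))]. *)
  have [s1 s1P rs1] := EVT_min ax (continuous_subspaceT cr).
  have [s2 s2P rs2] := EVT_min xb (continuous_subspaceT cr).
  move: s1P s2P; rewrite !in_itv/= => /andP[as1 s1x] /andP[xs2 s2b].
  have U1 : r s1 * itg a x u <= itg a x (fun x => r x * u x).
    rewrite -itgZ//; apply: le_itg => //.
      by move=> y; apply: cvgM; [exact: cvg_cst|exact: cu].
    by move=> y yax; rewrite ler_wpM2r// rs1// in_itv.
  have U2 : r s2 * itg x b u <= itg x b (fun x => r x * u x).
    rewrite -itgZ//; apply: le_itg => //.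
      by move=> y; apply: cvgM; [exact: cvg_cst|exact: cu].
    by move=> y yxb; rewrite ler_wpM2r// rs2// in_itv.
  have UE : U = itg a x (fun x => r x * u x) + itg x b (fun x => r x * u x).
    exact: itg_cat.
  have Ug : (r s1 + r s2) * (g x ^+ 2 / (2 * (b - a))) <= U.
    rewrite UE mulrDl lerD//.
      by apply: le_trans U1; rewrite ler_wpM2l// ltW.
    by apply: le_trans U2; rewrite ler_wpM2l// ltW.
  have rx := rP s1 x s2 as1 s1x xs2 s2b.
  apply: (@le_trans _ _ (kap * (r s1 + r s2) * g x ^+ 2)).
    by rewrite ler_wpM2r// sqr_ge0.
  rewrite (_ : kap * (r s1 + r s2) * g x ^+ 2 = 2 * (b - a) * kap *
    ((r s1 + r s2) * (g x ^+ 2 / (2 * (b - a))))); last first.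
    by field; rewrite gt_eqF.
  by rewrite ler_wpM2l// mulr_ge0// mulr_ge0// ltW.
have abW := ltW ab.
(* Integrating the pointwise bound over [[a, b]] produces the factor [2 * c * kap * (b - a) ^+ 2],
   at most 1 by hypothesis. *)
have crgU : c * itg a b (fun x => r x * g x ^+ 2) <= U.
  have U0 : 0 <= U by apply: itg_ge0 => x _; rewrite mulr_ge0// ltW.
  apply: (@le_trans _ _ (c * (2 * (b - a) * kap * U * (b - a)))).
    rewrite ler_wpM2l// -(itg_cst a b (2 * (b - a) * kap * U))//.
    apply: le_itg => //.
    exact: cst_continuous.
  rewrite (_ : _ * _ = (2 * c * kap * (b - a) ^+ 2) * U); last by ring.
  by rewrite ler_piMl.
(* Integration by parts: the integrand is the derivative of [r * g], which vanishes at both ends.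
   Subtracting it trades [- P * g] for [r * (t - 1)], which completes [- ln t] to [u]. *)
have parts : itg a b (fun x => P x * g x + r x * (t x - 1)) = 0.
  have -> : 0 = r b * g b - r a * g a by rewrite /g Ta Tb !subrr !mulr0 subrr.
  apply: (itg_FTC2 a b (fun x => r x * g x)); first exact: ltW.
  - move=> x; apply: cvgD; first by apply: cvgM; [exact: cP|exact: cg].
    apply: cvgM; first exact: cr.
    by apply: cvgB; [exact: ct|exact: cvg_cst].
  - by move=> x; apply: cvgM; [exact: cr|exact: cg].
  - move=> x xab; rewrite (_ : _ + _ = r x *: (t x - 1 : R) + g x *: P x).
      exact: (is_deriveM (dr x xab) (dg x xab)).
    by rewrite /GRing.scale/=; ring.
have cPg : continuous (fun x => P x * g x + r x * (t x - 1)).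
  move=> x; apply: cvgD; first by apply: cvgM; [exact: cP|exact: cg].
  by apply: cvgM; [exact: cr|apply: cvgB; [exact: ct|exact: cvg_cst]].
have cZ k (f : R -> R) : continuous f -> continuous (fun x => k * f x).
  by move=> cf x; apply: cvgM; [exact: cvg_cst|exact: cf].
have cD (f h : R -> R) : continuous f -> continuous h ->
    continuous (fun x => f x + h x).
  by move=> cf ch x; apply: cvgD; [exact: cf|exact: ch].
have cB (f h : R -> R) : continuous f -> continuous h ->
    continuous (fun x => f x - h x).
  by move=> cf ch x; apply: cvgB; [exact: cf|exact: ch].
pose k := ln W - ln Z.
(* This is the constraint [H] at [y = T x], where the definition of [t] expresses [ln (w (T x))]
   through [ln (r x)] and [ln (t x)]. *)
have key : itg a b (fun x => k * r x + (r x * u x - c * (r x * g x ^+ 2)) -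
    (P x * g x + r x * (t x - 1))) <= itg a b m.
  apply: le_itg => //.
    by apply: (cB _ _ _ cPg); apply: cD; [|apply: cB => //]; apply: cZ.
  move=> x xab; apply: le_trans (H x (T x) xab (Tab x)).
  have -> : ln (w (T x)) = ln (r x) + k - ln (t x).
    by rewrite /t /k !(ln_div, lnV, lnM) ?posrE ?divr_gt0 ?invr_gt0//; ring.
  by rewrite /u /g; lra.
move: key; rewrite itgB//; last by apply: cD; [|apply: cB => //]; apply: cZ.
rewrite parts subr0 itgD//; last 2 first.
- exact: cZ.
- by apply: cB => //; apply: cZ.
rewrite itgB//; last exact: cZ.
rewrite !itgZ// -/U -/Z /k mulrC; apply: le_trans.
by rewrite lerDl subr_ge0.
Qed.

End transport_inequality_1d.

(** * Continuity of real- and vector-valued functions *)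

Section continuous_arithmetic.
Context {R : realType} {T : topologicalType}.
Implicit Types f g : T -> R.

Lemma continuousT_add f g : continuous f -> continuous g ->
  continuous (fun x => f x + g x).
Proof. by move=> cf cg x; exact: cvgD (cf x) (cg x). Qed.

Lemma continuousT_opp f : continuous f -> continuous (fun x => - f x).
Proof. by move=> cf x; exact: cvgN (cf x). Qed.

Lemma continuousT_sub f g : continuous f -> continuous g ->
  continuous (fun x => f x - g x).
Proof. by move=> cf cg x; exact: cvgB (cf x) (cg x). Qed.

Lemma continuousT_mul f g : continuous f -> continuous g ->
  continuous (fun x => f x * g x).
Proof. by move=> cf cg x; exact: cvgM (cf x) (cg x). Qed.

Lemma continuousT_scale k f : continuous f -> continuous (fun x => k * f x).
Proof. by apply: continuousT_mul; exact: cst_continuous. Qed.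

End continuous_arithmetic.

Lemma continuous_pair (T U V : topologicalType) (f : T -> U) (g : T -> V) :
  continuous f -> continuous g -> continuous (fun t => (f t, g t)).
Proof. by move=> cf cg t; exact: (cvg_pair (cf t) (cg t)). Qed.

Lemma continuousT_comp (T U V : topologicalType) (f : T -> U) (g : U -> V) :
  continuous f -> continuous g -> continuous (g \o f).
Proof. by move=> cf cg t; exact: continuous_comp (cf t) (cg (f t)). Qed.
Arguments continuousT_comp {T U V f g}.

Lemma continuous_rV (R : realType) (T : topologicalType) n (f : T -> 'rV[R]_n) :
  (forall i, continuous (fun t => f t ord0 i)) -> continuous f.
Proof.
move=> cf t; apply/cvg_ballP => e e0.
have : \forall t' \near t, forall i, ball (f t ord0 i) e (f t' ord0 i).
  apply: filter_forall => i; have /cvg_ballP := cf i t; exact.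
apply: filterS => t' tt'; split=> // i j; rewrite ord1; exact: tt'.
Qed.

Lemma consrV_continuous (R : realType) n : continuous (@consrV R n).
Proof.
apply: continuous_rV => i; case: (unliftP ord0 i) => [j ->|->] p.
- have -> : (fun t : R * 'rV[R]_n => consrV t ord0 (lift ord0 j)) =
      (fun t => t.2 ord0 j) by apply/funext => t; rewrite consrVS.
  apply: (continuous_comp (f := snd) (g := fun x : 'rV[R]_n => x ord0 j)).
    exact: cvg_snd.
  exact: coord_continuous.
- have -> : (fun t : R * 'rV[R]_n => consrV t ord0 ord0) = fst.
    by apply/funext => t; rewrite consrV0.
  exact: cvg_fst.
Qed.

(** * Integrals depending on a parameter *)

Section parametric_integral.
Context {R : realType} {U : topologicalType}.

(** Compactness of [[a, b]], in its near-covering form, yields one neighbourhood of [u0] that serves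
    all [s] at once. *)
Lemma near_segment_continuous (f : U * R -> R) (a b : R) (u0 : U) (e : R) :
  continuous f -> 0 < e ->
  \forall u \near u0, forall s, a <= s <= b -> `|f (u, s) - f (u0, s)| < e.
Proof.
move=> cf e0.
have cP := (@compact_near_coveringP R^o `[a, b]).1 (@segment_compact R a b).
have := cP U (nbhs u0) (fun u s => `|f (u, s) - f (u0, s)| < e) _.
move=> /(_ (nbhs_filter u0)) h; apply: filterS (h _); last first.
  move=> s _; have e20 : 0 < e / 2 by rewrite divr_gt0.
  have /cvgrPdist_lt/(_ _ e20)[[/= A B] [uA sB] AB] := cf (u0, s).
  exists (B, A) => // -[s' u] /= [Bs' Au].
  have h1 := AB (u, s') (conj Au Bs').
  have h2 := AB (u0, s') (conj (nbhs_singleton uA) Bs').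
  rewrite /= in h1 h2.
  rewrite -(subrKA (f (u0, s))) (splitr e) (le_lt_trans (ler_normD _ _))//.
  by rewrite ltrD// distrC.
by move=> u hu s sab; apply: hu; rewrite /= in_itv.
Qed.

Lemma continuous_slice (f : U * R -> R) (u : U) :
  continuous f -> continuous (fun s => f (u, s)).
Proof.
have cu : continuous (fun s : R => (u, s)).
  by apply: continuous_pair; [exact: cst_continuous|move=> s; exact: cvg_id].
exact: continuousT_comp cu.
Qed.

Lemma continuous_itg (f : U * R -> R) (a b : R) : a <= b ->
  continuous f -> continuous (fun u => itg a b (fun s => f (u, s))).
Proof.
move=> ab cf u0; apply/cvgrPdist_le => e e0.
(* The summand 1 keeps the denominator positive when [a = b]. *)
have d0 : 0 < e / (b - a + 1) by rewrite divr_gt0// ltr_wpDl ?subr_ge0.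
apply: filterS (near_segment_continuous f a b u0 _ cf d0) => u fu.
rewrite -itgB//; [|exact: continuous_slice..].
have cc c : continuous (fun _ : R => c : R) by exact: cst_continuous.
have cd : continuous (fun s => f (u0, s) - f (u, s)).
  by move=> s; apply: cvgB; exact: continuous_slice.
have le1 (s : R) : a <= s <= b ->
    - (e / (b - a + 1)) <= f (u0, s) - f (u, s) <= e / (b - a + 1).
  by move=> sab; rewrite -ler_norml distrC ltW// fu.
have eab : e / (b - a + 1) * (b - a) <= e.
  rewrite mulrAC ler_pdivrMr ?ltr_wpDl ?subr_ge0// ler_pM2l//.
  by rewrite lerDl.
rewrite ler_norml; apply/andP; split.
- apply: (@le_trans _ _ (itg a b (fun=> - (e / (b - a + 1))))).
    by rewrite itg_cst// mulNr lerN2.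
  by apply: le_itg => // s /le1/andP[].
- apply: (@le_trans _ _ (itg a b (fun=> e / (b - a + 1)))).
    by apply: le_itg => // s /le1/andP[].
  by rewrite itg_cst.
Qed.

End parametric_integral.

(** Differentiation under the integral sign. Uniform continuity of [p] along the segment bounds the
    derivative near [s] by [|p (s, x)| + 1], an integrable dominating function. *)
Lemma is_derive_itg (R : realType) (f p : R * R -> R) (a b c d : R) (s : R) :
  a <= b -> continuous f -> continuous p ->
  (forall u x, c < u < d -> a <= x <= b ->
     is_derive u 1 (fun v => f (v, x)) (p (u, x))) ->
  c < s < d ->
  is_derive s 1 (fun u => itg a b (fun x => f (u, x)))
    (itg a b (fun x => p (s, x))).
Proof.
move=> ab cf cp dfp /andP[cs sd].
have := near_segment_continuous p a b s _ cp ltr01.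
have scd : s \in `]c, d[ by rewrite in_itv/= cs.
move=> /(filterI (near_in_itvoo scd))[e /= e0 sub].
have subI u : s - e < u < s + e ->
    c < u < d /\ forall x, a <= x <= b -> `|p (u, x) - p (s, x)| < 1.
  move=> use; have : ball s e u by rewrite /ball/= ltr_distlC.
  by move=> /sub[]; rewrite in_itv/=.
have dp u x : s - e < u < s + e -> a <= x <= b ->
    'D_1 (fun v => f (v, x)) u = p (u, x).
  by move=> /subI[ucd _] xab; have [] := dfp u x ucd xab.
have se : s - e < s < s + e by rewrite gtrBl e0 ltrDl.
have cG : continuous (fun x => `|p (s, x)| + 1).
  move=> x; apply: cvgD; last exact: cvg_cst.
  by apply: (@cvg_norm _ _ _ _ _ (fun x => p (s, x))); exact: continuous_slice.
pose g u x := f (u, x).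
have Ise : `]s - e, s + e[%classic s by rewrite /= in_itv.
have h1 (u : R) : `]s - e, s + e[%classic u ->
    (@lebesgue_measure R).-integrable `[a, b] (EFin \o g u).
  by move=> _; apply: itg_integrable; exact: continuous_slice.
have h2 (u x : R) : `]s - e, s + e[%classic u -> `[a, b]%classic x ->
    derivable (g ^~ x) u 1.
  rewrite /= !in_itv/= => /subI[ucd _] xab.
  by have [] := dfp u x ucd xab.
have h3 (x : R) : 0 <= `|p (s, x)| + 1 by rewrite addr_ge0.
have h4 (u x : R) : `]s - e, s + e[%classic u -> `[a, b]%classic x ->
    `|partial1of2 g u x| <= `|p (s, x)| + 1.
  rewrite /= !in_itv/= => use xab; rewrite partial1of2E dp//.
  have [_ /(_ x xab) /ltW pe] := subI u use.
  by rewrite -lerBlDl (le_trans (lerB_dist _ _)).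
have mab : measurable (`[a, b]%classic : set (measurableTypeR R)) by [].
have iG := itg_integrable a b _ cG.
have dF := @derivable_under_integral R _ _ lebesgue_measure g _ mab s _ _ Ise
  h1 h2 _ h3 iG h4.
have F' := @differentiation_under_integral R _ _ lebesgue_measure g _ mab s _ _
  Ise h1 h2 _ h3 iG h4.
apply: DeriveDef; first exact: dF.
rewrite -derive1E; apply: etrans F' _; apply: eq_itg => x xab.
by rewrite partial1of2E dp.
Qed.

(** * Iterated integrals over a closed cube *)

Section iterated_integral.
Context {R : realType}.

Definition tailrV n (a : 'rV[R]_n.+1) : 'rV[R]_n := (unconsrV a).2.

(** The first coordinate is the outermost variable, as in the recursion of [lebesgue_rV], so that
    inductions on the dimension proceed by slices. *)
Fixpoint itgn (n : nat) : 'rV[R]_n -> R -> ('rV[R]_n -> R) -> R :=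
  match n with
  | 0 => fun _ _ f => f 0
  | n'.+1 => fun a l f => itg (a ord0 ord0) (a ord0 ord0 + l)
      (fun s => itgn n' (tailrV n' a) l (fun x => f (consrV (s, x))))
  end.

Definition closed_box n (a : 'rV[R]_n) (l : R) (x : 'rV[R]_n) :=
  forall i, a ord0 i <= x ord0 i <= a ord0 i + l.

Lemma closed_box_consrV n (a : 'rV[R]_n.+1) l s x :
  a ord0 ord0 <= s <= a ord0 ord0 + l -> closed_box n (tailrV n a) l x ->
  closed_box n.+1 a l (consrV (s, x)).
Proof.
move=> sa xa i; case: (unliftP ord0 i) => [j ->|->]; last by rewrite consrV0.
by rewrite consrVS; have := xa j; rewrite mxE.
Qed.

Lemma continuous_consrV_slice n (f : 'rV[R]_n.+1 -> R) s :
  continuous f -> continuous (fun x => f (consrV (s, x))).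
Proof.
have cs : continuous (fun x : 'rV[R]_n => (s, x)).
  by apply: continuous_pair; [exact: cst_continuous|move=> ?; exact: cvg_id].
move=> cf.
exact: continuousT_comp (continuousT_comp cs (@consrV_continuous R n)) cf.
Qed.

Lemma continuous_consrV_assoc (U : topologicalType) n :
  continuous (fun v : (U * R) * 'rV[R]_n => (v.1.1, consrV (v.1.2, v.2))).
Proof.
have c1 : continuous (fun v : (U * R) * 'rV[R]_n => v.1).
  by move=> v; exact: cvg_fst.
have c2 : continuous (fun v : (U * R) * 'rV[R]_n => v.2).
  by move=> v; exact: cvg_snd.
have c11 : continuous (@fst U R) by move=> v; exact: cvg_fst.
have c12 : continuous (@snd U R) by move=> v; exact: cvg_snd.
apply: continuous_pair; first exact: continuousT_comp c1 c11.
have c : continuous (fun v : (U * R) * 'rV[R]_n => (v.1.2, v.2)).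
  by apply: continuous_pair => //; exact: continuousT_comp c1 c12.
exact: continuousT_comp c (@consrV_continuous R n).
Qed.

(** The parameter space is left general because the induction moves the first coordinate into it,
    passing from [U] to [U * R]. *)
Lemma continuous_itgn n (U : topologicalType) (a : 'rV[R]_n) (l : R)
    (f : U * 'rV[R]_n -> R) : 0 <= l ->
  continuous f -> continuous (fun u => itgn n a l (fun x => f (u, x))).
Proof.
move=> l0; elim: n U a f => [|n IH] U a f cf /=.
  have c0 : continuous (fun u : U => (u, 0 : 'rV[R]_0)).
    by apply: continuous_pair; [move=> ?; exact: cvg_id|exact: cst_continuous].
  exact: continuousT_comp c0 cf.
apply: (continuous_itg
  (fun v : U * R => itgn n (tailrV n a) l (fun x => f (v.1, consrV (v.2, x))))).
  by rewrite lerDl.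
apply: (IH (U * R)%type (tailrV n a) (fun v => f (v.1.1, consrV (v.1.2, v.2)))).
exact: continuousT_comp (continuous_consrV_assoc U n) cf.
Qed.

Lemma continuous_itgn_slice n (a : 'rV[R]_n) (l : R) (f : 'rV[R]_n.+1 -> R) :
  0 <= l -> continuous f ->
  continuous (fun s => itgn n a l (fun x => f (consrV (s, x)))).
Proof.
move=> l0 cf; apply: (continuous_itgn n R a l (f \o @consrV R n)) => //.
exact: continuousT_comp (@consrV_continuous R n) cf.
Qed.

Lemma le_itgn n (a : 'rV[R]_n) (l : R) (f g : 'rV[R]_n -> R) :
  0 <= l -> continuous f -> continuous g ->
  (forall x, closed_box n a l x -> f x <= g x) -> itgn n a l f <= itgn n a l g.
Proof.
move=> l0; elim: n a f g => [|n IH] a f g cf cg fg /=; first by apply: fg => -[].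
apply: le_itg => [||s sa]; [exact: continuous_itgn_slice..|].
apply: IH => [||x xa]; [exact: continuous_consrV_slice..|].
by apply: fg; exact: closed_box_consrV.
Qed.

Lemma itgnD n (a : 'rV[R]_n) (l : R) (f g : 'rV[R]_n -> R) :
  0 <= l -> continuous f -> continuous g ->
  itgn n a l (fun x => f x + g x) = itgn n a l f + itgn n a l g.
Proof.
move=> l0; elim: n a f g => [//|n IH] a f g cf cg /=.
rewrite -itgD; [|exact: continuous_itgn_slice..].
by apply: eq_itg => s _; apply: IH; exact: continuous_consrV_slice.
Qed.

Lemma itgnZ n (a : 'rV[R]_n) (l c : R) (f : 'rV[R]_n -> R) :
  0 <= l -> continuous f ->
  itgn n a l (fun x => c * f x) = c * itgn n a l f.
Proof.
move=> l0; elim: n a f => [//|n IH] a f cf /=.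
rewrite -itgZ; last exact: continuous_itgn_slice.
by apply: eq_itg => s _; apply: IH; exact: continuous_consrV_slice.
Qed.

Lemma itgn_gt0 n (a : 'rV[R]_n) (l : R) (f : 'rV[R]_n -> R) :
  0 < l -> continuous f ->
  (forall x, closed_box n a l x -> 0 < f x) -> 0 < itgn n a l f.
Proof.
move=> l0; elim: n a f => [|n IH] a f cf f0 /=; first by apply: f0 => -[].
apply: itg_gt0 => [||s sa]; first by rewrite ltrDl.
  by apply: continuous_itgn_slice => //; exact: ltW.
apply: IH => [|x xa]; first exact: continuous_consrV_slice.
by apply: f0; exact: closed_box_consrV.
Qed.

Lemma is_derive_itgn n (a : 'rV[R]_n) (l : R)
    (f p : R * 'rV[R]_n -> R) (b c s : R) :
  0 <= l -> continuous f -> continuous p ->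
  (forall u x, b < u < c -> closed_box n a l x ->
     is_derive u 1 (fun v => f (v, x)) (p (u, x))) ->
  b < s < c ->
  is_derive s 1 (fun u => itgn n a l (fun x => f (u, x)))
    (itgn n a l (fun x => p (s, x))).
Proof.
move=> l0; elim: n a f p s => [|n IH] a f p s cf cp dfp sbc /=.
  by apply: dfp => // -[].
have cc (h : R * 'rV[R]_n.+1 -> R) : continuous h ->
    continuous (fun v : R * R * 'rV[R]_n => h (v.1.1, consrV (v.1.2, v.2))).
  by move=> ch; exact: continuousT_comp (continuous_consrV_assoc R n) ch.
pose F (h : R * 'rV[R]_n.+1 -> R) (v : R * R) :=
  itgn n (tailrV n a) l (fun x => h (v.1, consrV (v.2, x))).
have cF h : continuous h -> continuous (F h).
  by move=> ch; exact: (continuous_itgn n (R * R)%type _ _ _ l0 (cc h ch)).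
apply: (is_derive_itg R (F f) (F p) _ _ b c s _ (cF f cf) (cF p cp)) => //.
  by rewrite lerDl.
move=> u y ubc ya.
have cs (h : R * 'rV[R]_n.+1 -> R) : continuous h ->
    continuous (fun v : R * 'rV[R]_n => h (v.1, consrV (y, v.2))).
  move=> ch; have cy : continuous (fun v : R * 'rV[R]_n => (y, v.2)).
    by apply: continuous_pair; [exact: cst_continuous|move=> v; exact: cvg_snd].
  have cy' : continuous (fun v : R * 'rV[R]_n => (v.1, consrV (y, v.2))).
    apply: continuous_pair; first by move=> v; exact: cvg_fst.
    exact: continuousT_comp cy (@consrV_continuous R n).
  exact: continuousT_comp cy' ch.
apply: (IH (tailrV n a) (fun v => f (v.1, consrV (y, v.2)))
  (fun v => p (v.1, consrV (y, v.2))) u (cs f cf) (cs p cp)) => // v x vbc xa.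
exact: (dfp v (consrV (y, x)) vbc (closed_box_consrV _ _ _ _ _ ya xa)).
Qed.

End iterated_integral.

(** * The transport-entropy inequality in every dimension *)

Section transport_inequality.
Context {R : realType}.

Definition upd n (x : 'rV[R]_n) (i : 'I_n) (s : R) : 'rV[R]_n :=
  \row_j if j == i then s else x ord0 j.

Lemma upd_consrV0 n (x : 'rV[R]_n) (t s : R) :
  upd n.+1 (consrV (t, x)) ord0 s = consrV (s, x).
Proof.
apply/rowP => j; rewrite mxE; case: (unliftP ord0 j) => [k ->|->].
  by rewrite !consrVS.
by rewrite eqxx consrV0.
Qed.

Lemma upd_consrVS n (x : 'rV[R]_n) (t s : R) i :
  upd n.+1 (consrV (t, x)) (lift ord0 i) s = consrV (t, upd n x i s).
Proof.
apply/rowP => j; rewrite mxE; case: (unliftP ord0 j) => [k ->|->].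
  by rewrite !consrVS mxE (inj_eq lift_inj).
by rewrite !consrV0.
Qed.

(** Induction on [n]: the one-dimensional inequality is applied to the marginals [S r], [S w], [S m]
    along the first coordinate. Its constraint at [(s, u)] is the induction hypothesis for the
    slices of [r] at [s] and of [w] at [u]. The other hypotheses on [r] pass to marginals because
    they are linear in [r] and its derivative. *)
Theorem transport_inequality n (a : 'rV[R]_n) (l kap c : R)
    (r w m : 'rV[R]_n -> R) (p : 'I_n -> 'rV[R]_n -> R) :
  0 < l -> 0 <= kap -> 0 <= c -> 2 * c * kap * l ^+ 2 <= 1 ->
  continuous r -> continuous w -> continuous m -> (forall i, continuous (p i)) ->
  (forall x, 0 < r x) -> (forall x, 0 < w x) ->
  (forall i x s, closed_box n a l x -> a ord0 i < s < a ord0 i + l ->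
    is_derive s 1 (fun u => r (upd n x i u)) (p i (upd n x i s))) ->
  (forall i x s1 s s2, closed_box n a l x -> a ord0 i <= s1 -> s1 <= s ->
    s <= s2 -> s2 <= a ord0 i + l ->
    r (upd n x i s) <= kap * (r (upd n x i s1) + r (upd n x i s2))) ->
  (forall x y, closed_box n a l x -> closed_box n a l y ->
    r x * (ln (w y) - ln (r x)) - \sum_i p i x * (y ord0 i - x ord0 i) -
    c * r x * \sum_i (x ord0 i - y ord0 i) ^+ 2 <= m x) ->
  itgn n a l r * (ln (itgn n a l w) - ln (itgn n a l r)) <= itgn n a l m.
Proof.
move=> l0 kap0 c0 ckap.
elim: n a r w m p => [|n IH] a r w m p cr cw cm cp r0 w0 dr rP H.
  by have := H 0 0; rewrite !big_ord0 subr0 mulr0 subr0; apply=> -[].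
have l0' := ltW l0.
pose S (h : 'rV[R]_n.+1 -> R) s :=
  itgn n (tailrV n a) l (fun x => h (consrV (s, x))).
have cS (h : 'rV[R]_n.+1 -> R) : continuous h -> continuous (S h).
  by move=> ch; exact: continuous_itgn_slice.
have S0 (h : 'rV[R]_n.+1 -> R) s : continuous h -> (forall x, 0 < h x) -> 0 < S h s.
  by move=> ch h0; apply: itgn_gt0 => //; exact: continuous_consrV_slice.
apply: (transport_inequality_1d _ _ kap c (S r) (S (p ord0)) (S w) (S m)).
- by rewrite ltrDl.
- exact: cS.
- exact: cS.
- exact: cS.
- exact: cS.
- by move=> s; exact: S0.
- by move=> s; exact: S0.
- move=> s sa; apply: (is_derive_itgn n _ _ (r \o @consrV R n)
    (p ord0 \o @consrV R n) (a ord0 ord0) (a ord0 ord0 + l)) => //.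
  + exact: continuousT_comp (@consrV_continuous R n) cr.
  + exact: continuousT_comp (@consrV_continuous R n) (cp ord0).
  + move=> u x ua xa.
    have ua' : a ord0 ord0 <= u <= a ord0 ord0 + l.
      by case/andP: ua => /ltW-> /ltW.
    have := dr ord0 (consrV (u, x)) u (closed_box_consrV _ _ _ _ _ ua' xa) ua.
    by under eq_fun do rewrite upd_consrV0; rewrite upd_consrV0.
- move=> s1 s s2 as1 s1s ss2 s2b.
  rewrite /S mulrDr -!itgnZ//; [|exact: continuous_consrV_slice..].
  have ck t : continuous (fun x => kap * r (consrV (t, x))).
    by apply: continuousT_scale; exact: continuous_consrV_slice.
  rewrite -itgnD//; apply: le_itgn => //.
  + exact: continuous_consrV_slice.
  + by apply: continuousT_add; exact: ck.
  + move=> x xa.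
    have s1a : a ord0 ord0 <= s1 <= a ord0 ord0 + l.
      by rewrite as1 (le_trans s1s)// (le_trans ss2).
    have := rP ord0 (consrV (s1, x)) s1 s s2 (closed_box_consrV _ _ _ _ _ s1a xa)
      as1 s1s ss2 s2b.
    by rewrite !upd_consrV0 mulrDr.
- by [].
- by [].
- by rewrite addrAC subrr add0r.
move=> s u sa ua.
(* The contributions of the first coordinate to the constraint do not involve the remaining
   coordinates of the target point, so they can be absorbed into the bound on the slice. *)
pose m' x := m (consrV (s, x)) + (u - s) * p ord0 (consrV (s, x)) +
  c * (s - u) ^+ 2 * r (consrV (s, x)).
have cZ k (h : 'rV[R]_n.+1 -> R) : continuous h ->
    continuous (fun x : 'rV[R]_n => k * h (consrV (s, x))).
  by move=> ch; apply: continuousT_scale; exact: continuous_consrV_slice.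
have cmp : continuous (fun x => m (consrV (s, x)) + (u - s) * p ord0 (consrV (s, x))).
  by apply: continuousT_add; [exact: continuous_consrV_slice|exact: cZ].
have cm' : continuous m' by apply: continuousT_add; [exact: cmp|exact: cZ].
have := IH (tailrV n a) (fun x => r (consrV (s, x))) (fun x => w (consrV (u, x)))
  m' (fun i x => p (lift ord0 i) (consrV (s, x))).
rewrite -!/(S _ _) => /(_ _ _ cm')/=.
have -> : itgn n (tailrV n a) l m' =
    S m s + S (p ord0) s * (u - s) + c * S r s * (s - u) ^+ 2.
  rewrite /m' itgnD//; last exact: cZ.
  rewrite itgnD//; [|exact: continuous_consrV_slice|exact: cZ].
  rewrite !itgnZ//; [|exact: continuous_consrV_slice..].
  by rewrite -!/(S _ _); ring.
move=> h; suff : S r s * (ln (S w u) - ln (S r s)) <=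
  S m s + S (p ord0) s * (u - s) + c * S r s * (s - u) ^+ 2 by lra.
apply: h.
- exact: continuous_consrV_slice.
- exact: continuous_consrV_slice.
- by move=> i; exact: continuous_consrV_slice.
- by move=> x; exact: r0.
- by move=> x; exact: w0.
- move=> i x t xa ta.
  have := dr (lift ord0 i) (consrV (s, x)) t (closed_box_consrV _ _ _ _ _ sa xa).
  under eq_fun do rewrite upd_consrVS; rewrite upd_consrVS; apply.
  by move: ta; rewrite mxE.
- move=> i x s1 t s2 xa; rewrite mxE => as1 s1t ts2 s2a.
  have := rP (lift ord0 i) (consrV (s, x)) s1 t s2
    (closed_box_consrV _ _ _ _ _ sa xa) as1 s1t ts2 s2a.
  by rewrite !upd_consrVS.
- move=> x y xa ya.
  have := H (consrV (s, x)) (consrV (u, y)) (closed_box_consrV _ _ _ _ _ sa xa)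
    (closed_box_consrV _ _ _ _ _ ua ya).
  rewrite !big_ord_recl !consrV0.
  rewrite (eq_bigr (fun i => p (lift ord0 i) (consrV (s, x)) *
    (y ord0 i - x ord0 i))); last by move=> i _; rewrite !consrVS.
  have -> : \sum_i (consrV (s, x) ord0 (lift ord0 i) -
      consrV (u, y) ord0 (lift ord0 i)) ^+ 2 = \sum_i (x ord0 i - y ord0 i) ^+ 2.
    by apply: eq_bigr => i _; rewrite !consrVS.
  by rewrite /m' /=; lra.
Qed.

End transport_inequality.

(** * Iterated integrals as Lebesgue integrals *)

Section lebesgue_integral_box.
Context {R : realType}.

Lemma measurable_continuous_rV n (f : 'rV[R]_n -> R) : continuous f ->
  measurable_fun [set: borel_rV R n] (f : borel_rV R n -> measurableTypeR R).
Proof.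
move=> cf; apply: (measurability _ (RGenOpens.measurableE R)).
move=> _ [_ [a [b ->] <-]]; rewrite setTI; apply: open_measurable_rV.
by apply: open_comp; [move=> x _; exact: cf|exact: interval_open].
Qed.

Lemma measurable_closed_box n (a : 'rV[R]_n) (l : R) :
  measurable (closed_box n a l : set (borel_rV R n)).
Proof.
have -> : (closed_box n a l : set (borel_rV R n)) = \bigcap_(i in [set: 'I_n])
    ((fun x : borel_rV R n => (x : 'rV[R]_n) ord0 i : measurableTypeR R) @^-1`
      `[a ord0 i, a ord0 i + l]%classic).
  apply/seteqP; split=> [x /= xa i _|x /= xa i]; first by rewrite /= in_itv/=.
  by have := xa i Logic.I; rewrite /= in_itv.
apply: fin_bigcap_measurable => // i _.
by rewrite -[X in measurable X]setTI; exact: measurable_rV_coord.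
Qed.

Lemma preimage_consrV_closed_box n (a : 'rV[R]_n.+1) (l : R) :
  @consrV R n @^-1` closed_box n.+1 a l =
  `[a ord0 ord0, a ord0 ord0 + l]%classic `*` closed_box n (tailrV n a) l.
Proof.
apply/seteqP; split=> [[s x] /= sx|[s x] [/= sa xa]].
  split=> [|i /=]; first by have := sx ord0; rewrite consrV0 in_itv.
  by have := sx (lift ord0 i); rewrite consrVS mxE.
by apply: closed_box_consrV => //; move: sa; rewrite in_itv.
Qed.

(** [lebesgue_rV] in dimension [n + 1] is a pushforward of a product measure: change variables,
    extend the integrand by zero outside the box, and split off the first coordinate by Tonelli. *)
Lemma integral_closed_box n (a : 'rV[R]_n) (l : R) (f : 'rV[R]_n -> R) :
  0 <= l -> continuous f -> (forall x, 0 <= f x) ->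
  (\int[lebesgue_rV R n]_(x in closed_box n a l) (f x)%:E)%E =
  (itgn n a l f)%:E.
Proof.
move=> l0; elim: n a f => [|n IH] a f cf f0 /=.
  rewrite integral_dirac; last 2 first.
  - exact: measurable_closed_box.
  - apply/measurable_EFinP.
    by apply: measurable_funTS; exact: measurable_continuous_rV.
  by rewrite diracE mem_set ?mul1e// => -[].
set I := `[a ord0 ord0, a ord0 ord0 + l]%classic.
set B := closed_box n (tailrV n a) l.
have mB : measurable (B : set (borel_rV R n)) by exact: measurable_closed_box.
have mI : measurable (I : set (measurableTypeR R)) by exact: measurable_itv.
have mf : measurable_fun [set: borel_rV R n.+1]
    (fun x : borel_rV R n.+1 => (f x)%:E).
  by apply/measurable_EFinP; exact: measurable_continuous_rV.
have f0' : {in (closed_box n.+1 a l : set (borel_rV R n.+1)),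
    forall x, (0 <= (f x)%:E)%E} by move=> x _; rewrite lee_fin.
have h := (@ge0_integral_pushforward _ _ _ _ R _
  (@measurable_consrV R n) (lebesgue_measure \x lebesgue_rV R n)%E _ _
  (measurable_closed_box _ _ _) (measurable_funTS mf) f0').
apply: etrans; first exact: h.
rewrite preimage_consrV_closed_box integral_mkcond.
rewrite fubini_tonelli1; last 2 first.
- apply/(measurable_restrictT _ _).1.
  + exact: measurableX.
  + apply: measurable_funTS; apply: (measurableT_comp mf).
    exact: measurable_consrV.
- by move=> p; rewrite patchE; case: ifP => // _; rewrite /= lee_fin.
pose g s := itgn n (tailrV n a) l (fun x => f (consrV (s, x))).
have cg : continuous g by exact: continuous_itgn_slice.
transitivity (\int[lebesgue_measure]_(s in I) (g s)%:E)%E.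
  rewrite [RHS]integral_mkcond; apply: eq_integral => s _.
  rewrite /fubini_F patchE; case: ifPn => sI.
    rewrite -IH//; last exact: continuous_consrV_slice.
    rewrite [RHS]integral_mkcond; apply: eq_integral => x _.
    rewrite !patchE; congr (if _ then _ else _).
    by rewrite in_setX /= sI.
  rewrite integral0_eq// => x _; rewrite patchE in_setX /=.
  by rewrite (negbTE sI).
rewrite /itg /Rintegral fineK//.
apply: integrable_fin_num => //.
exact: itg_integrable.
Qed.

End lebesgue_integral_box.

(** * Derivatives along lines *)

Lemma is_derive_ge0_right (R : realType) (f : R -> R) (x d : R) :
  is_derive x 1 f d -> f x = 0 -> (\forall y \near x^'+, 0 <= f y) -> 0 <= d.
Proof.
move=> [df <-] fx fge.
have cvgf : (h^-1 *: (f (h *: (1 : R) + x) - f x)) @[h --> 0^'+] --> 'D_1 f x.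
  by apply: cvg_dnbhs_at_right; exact: df.
apply: (cvgr_to_ge cvgf); have := (nbhs_right0P x (fun y => 0 <= f y)).1 fge.
move=> h; near=> y; rewrite fx subr0 [y *: (1 : R)]mulr1 addrC.
have y0 : 0 < y by near: y; exact: nbhs_right_gt.
by apply: mulr_ge0; [rewrite invr_ge0 ltW|near: y; exact: h].
Unshelve. all: by end_near. Qed.

Lemma is_derive_line (R : realType) (V : normedModType R) (f : V -> R)
    (x v : V) (s : R) : derivable f (s *: v + x) v ->
  is_derive s 1 (fun u => f (u *: v + x)) ('D_v f (s *: v + x)).
Proof.
have E : (fun h : R => h^-1 *: ((fun u => f (u *: v + x)) (h *: (1 : R) + s) -
    f (s *: v + x))) =
    (fun h => h^-1 *: (f (h *: v + (s *: v + x)) - f (s *: v + x))).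
  apply/funext => h; congr (_ *: (f _ - _)).
  by rewrite [h *: (1 : R)]mulr1 scalerDl addrA.
move=> df; apply: DeriveDef; first by rewrite /derivable E.
by rewrite /derive E.
Qed.

(** * Convexity and openness of the cube *)

Section cube_theory.
Context {R : realType} (n : nat) (a : 'rV[R]_n) (l : R).

Lemma cubeP (x : 'rV[R]_n) :
  cube a l x <-> forall i, a ord0 i < x ord0 i < a ord0 i + l.
Proof. by split=> Cx i; have := Cx i; rewrite !mxE. Qed.

Lemma cube_convex (t : R) (x y : 'rV[R]_n) : 0 <= t <= 1 ->
  cube a l x -> cube a l y -> cube a l (t *: x + (1 - t) *: y).
Proof.
move=> /andP[t0 t1] /cubeP Cx /cubeP Cy; apply/cubeP => i; rewrite !mxE.
have /andP[x1 x2] := Cx i; have /andP[y1 y2] := Cy i.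
(* At [t = 0] and [t = 1] one summand loses its strict inequality, so these cases are separate. *)
move: t0; rewrite le_eqVlt => /predU1P[<-|t0].
  by rewrite mul0r add0r subr0 mul1r y1.
move: t1; rewrite le_eqVlt => /predU1P[->|t1].
  by rewrite subrr mul0r addr0 mul1r x1.
have t1' : 0 < 1 - t by rewrite subr_gt0.
apply/andP; split.
- have -> : a ord0 i = t * a ord0 i + (1 - t) * a ord0 i by ring.
  by rewrite ltrD// ltr_pM2l.
- have -> : a ord0 i + l = t * (a ord0 i + l) + (1 - t) * (a ord0 i + l) by ring.
  by rewrite ltrD// ltr_pM2l.
Qed.

Lemma near_cube (x : 'rV[R]_n) :
  cube a l x -> nbhs x [set y : 'rV[R]_n | cube a l y].
Proof.
move=> /cubeP Cx.
have near_i i : nbhs x [set y : 'rV[R]_n | a ord0 i < y ord0 i < a ord0 i + l].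
  have cxi := @coord_continuous R 1 n ord0 i x.
  have xi : x ord0 i \in `]a ord0 i, a ord0 i + l[ by rewrite in_itv; exact: Cx.
  apply: (@filterS _ (nbhs x) _ _ _ _ (cxi _ (near_in_itvoo xi))) => y /=.
  by rewrite in_itv.
by apply: filterS (filter_forall _ near_i) => y /cubeP.
Qed.

Lemma near_cube_line (T : topologicalType) (g : T -> R) (t : T) i (x : 'rV[R]_n) :
  {for t, continuous g} -> g t = 0 -> cube a l x ->
  nbhs t [set u | cube a l (g u *: delta_mx ord0 i + x)].
Proof.
move=> cg gt0 Cx.
have cgx : {for t, continuous (fun u => g u *: delta_mx ord0 i + x)}.
  apply: (@continuousD _ _ _ (fun u => g u *: delta_mx ord0 i) (cst x)).
    exact: continuousZr_tmp.
  exact: cst_continuous.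
by apply: cgx; rewrite gt0 scale0r add0r; exact: near_cube.
Qed.

End cube_theory.

(** * Convex functions with partial derivatives on the cube *)

Section convex_on_cube.
Context {R : realType} (n : nat) (a : 'rV[R]_n) (l : R) (psi : 'rV[R]_n -> R).
Context (psi_convex : convex_function (cube a l) psi).

Let C : set 'rV[R]_n := cube a l.

Let convpsi (t : R) x y : 0 <= t <= 1 -> C x -> C y ->
  psi (t *: x + (1 - t) *: y) <= t * psi x + (1 - t) * psi y.
Proof.
move=> /andP[t0 t1] Cx Cy.
have := psi_convex (@Itv01 R t t0 t1) x y; rewrite !inE => /(_ Cx Cy).
by [].
Qed.

(** The average is a convex combination of the first point and the average of the others. Membership
    in the cube is carried along because convexity is available only there. *)
Let jensen k (y : 'I_k.+1 -> 'rV[R]_n) : (forall j, C (y j)) ->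
  C (k.+1%:R^-1 *: \sum_j y j) /\
  psi (k.+1%:R^-1 *: \sum_j y j) <= k.+1%:R^-1 * \sum_j psi (y j).
Proof.
elim: k y => [|k IH] y Cy.
  by rewrite !big_ord1 invr1 scale1r mul1r.
have [Ck pk] := IH (fun j => y (lift ord0 j)) (fun j => Cy _).
rewrite [\sum_(j < k.+2) y j]big_ord_recl [\sum_(j < k.+2) psi _]big_ord_recl.
set z := \sum_(j < k.+1) y (lift ord0 j) in Ck pk *.
set t : R := k.+2%:R^-1.
have k1 : (k.+1%:R : R) != 0 by rewrite pnatr_eq0.
have k2 : (k.+2%:R : R) != 0 by rewrite pnatr_eq0.
have tE : 1 - t = t * k.+1%:R.
  rewrite /t [in RHS](_ : k.+1%:R = k.+2%:R - 1); last by rewrite -[k.+2]addn1 natrD addrK.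
  by field.
have E : t *: (y ord0 + z) = t *: y ord0 + (1 - t) *: (k.+1%:R^-1 *: z).
  by rewrite scalerDr scalerA tE mulfK.
have t01 : 0 <= t <= 1.
  by rewrite invr_ge0 ler0n/= invf_le1 ?ltr0n// ler1n.
rewrite E; split; first exact: (cube_convex n a l _ _ _ t01 (Cy _) Ck).
apply: (le_trans (convpsi _ _ _ t01 (Cy _) Ck)).
rewrite mulrDr lerD2l (le_trans (ler_wpM2l _ pk))//.
  by case/andP: t01; rewrite subr_ge0.
by rewrite mulrA tE mulfK.
Qed.

Let jensenP k (y : 'I_k -> 'rV[R]_n) : (0 < k)%N -> (forall j, C (y j)) ->
  C (k%:R^-1 *: \sum_j y j) /\
  psi (k%:R^-1 *: \sum_j y j) <= k%:R^-1 * \sum_j psi (y j).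
Proof. by case: k y => // k y _ Cy; exact: jensen. Qed.

Let e (i : 'I_n) : 'rV[R]_n := delta_mx ord0 i.

(* [v + x] is the average of the points [x + n v_i e_i], which controls [psi] in
   all directions by its behaviour along the axes. *)
Let coord_jensen (x v : 'rV[R]_n) : (0 < n)%N ->
  (forall i, C ((n%:R * v ord0 i) *: e i + x)) ->
  C (v + x) /\
  psi (v + x) <= n%:R^-1 * \sum_i psi ((n%:R * v ord0 i) *: e i + x).
Proof.
move=> n0 Cv; have n0' : (n%:R : R) != 0 by rewrite pnatr_eq0 -lt0n.
rewrite (_ : v + x = n%:R^-1 *: \sum_i ((n%:R * v ord0 i) *: e i + x)).
  exact: jensenP.
rewrite big_split/= sumr_const card_ord scalerDr -[x *+ n]scaler_nat scalerA mulVf//.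
rewrite scale1r; congr (_ + _); rewrite scaler_sumr [LHS]row_sum_delta.
by apply: eq_bigr => i _; rewrite scalerA mulrA mulVf// mul1r.
Qed.

Context (psi_derivable : forall i x, cube a l x -> derivable psi x (delta_mx ord0 i)).

Let dpsi i (x : 'rV[R]_n) : R := 'D_(e i) psi x.

Let line_derive i (x : 'rV[R]_n) s : C (s *: e i + x) ->
  is_derive s 1 (fun u => psi (u *: e i + x)) (dpsi i (s *: e i + x)).
Proof. by move=> Cx; apply: is_derive_line; exact: psi_derivable. Qed.

Let line_continuous i (x : 'rV[R]_n) s : C (s *: e i + x) ->
  {for s, continuous (fun u : R => psi (u *: e i + x))}.
Proof.
move=> Cx; apply: differentiable_continuous; apply/derivable1_diffP.
by have [] := line_derive i x s Cx.
Qed.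

(** Continuity along the axes and [coord_jensen] bound [psi] from above near [x]. The lower bound
    follows by reflection, since [x] is the midpoint of [y] and [x - y + x]. *)
Lemma convex_continuous (x : 'rV[R]_n) : cube a l x -> {for x, continuous psi}.
Proof.
move=> Cx; apply/(@cvgrPdist_lt _ _ _ (nbhs x)) => eps eps0.
have [n0|n0] := posnP n.
  near=> y; have -> : y = x by apply/rowP => i; have := ltn_ord i; rewrite {2}n0.
  by rewrite subrr normr0.
have N0 : 0 < (n%:R : R) by rewrite ltr0n.
have cline (k : R) i : nbhs x [set y : 'rV[R]_n |
    C ((n%:R * (k *: (y - x)) ord0 i) *: e i + x) /\
    `|psi x - psi ((n%:R * (k *: (y - x)) ord0 i) *: e i + x)| < eps].
  pose g (y : 'rV[R]_n) := n%:R * (k *: (y - x)) ord0 i.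
  have gx : g x = 0 by rewrite /g subrr scaler0 mxE mulr0.
  have cg : continuous g.
    have -> : g = (fun y => n%:R * (k * (y ord0 i - x ord0 i))).
      by apply/funext => y; rewrite /g !mxE.
    do 2 apply: continuousT_scale.
    apply: continuousT_sub; last exact: cst_continuous.
    by move=> y; exact: coord_continuous.
  have C0 : C (g x *: e i + x) by rewrite gx scale0r add0r.
  have := line_continuous i x (g x) C0.
  move=> /(continuous_comp (cg x))/cvgrPdist_lt/(_ _ eps0).
  rewrite /= gx scale0r add0r => h.
  exact: filterI (near_cube_line n a l _ g x i x (cg x) gx Cx) h.
have near1 := @filter_forall _ _ _ (nbhs x) _ (cline 1).
have near2 := @filter_forall _ _ _ (nbhs x) _ (cline (-1)).
have near3 := near_cube n a l x Cx.
have bound (v : 'rV[R]_n) : (forall i, C ((n%:R * v ord0 i) *: e i + x) /\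
    `|psi x - psi ((n%:R * v ord0 i) *: e i + x)| < eps) ->
    C (v + x) /\ psi (v + x) < psi x + eps.
  move=> hv; have [|Cvx h] := coord_jensen x v n0; first by move=> i; have [] := hv i.
  split=> //; apply: le_lt_trans h _; rewrite mulrC ltr_pdivrMr//.
  rewrite (_ : _ * n%:R = \sum_(i < n) (psi x + eps)); last first.
    by rewrite sumr_const card_ord mulr_natr.
  apply: ltr_sum => [|i _]; last first.
    have [_] := hv i; rewrite ltr_distlC => /andP[_]; lra.
  by apply/hasP; exists (Ordinal n0) => //; rewrite mem_index_enum.
near=> y.
have Cy : C y by near: y.
have y1 : forall i, C ((n%:R * (1 *: (y - x)) ord0 i) *: e i + x) /\
    `|psi x - psi ((n%:R * (1 *: (y - x)) ord0 i) *: e i + x)| < eps.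
  by near: y; exact: near1.
have y2 : forall i, C ((n%:R * (-1 *: (y - x)) ord0 i) *: e i + x) /\
    `|psi x - psi ((n%:R * (-1 *: (y - x)) ord0 i) *: e i + x)| < eps.
  by near: y; exact: near2.
have [_] := bound _ y1; have [] := bound _ y2.
rewrite scaleN1r opprB scale1r subrK => C2 b2 b1.
have h01 : 0 <= (2^-1 : R) <= 1 by lra.
have := convpsi _ _ _ h01 Cy C2.
have -> : 2^-1 *: y + (1 - 2^-1) *: (x - y + x) = x.
  by apply/rowP => i; rewrite !mxE; field.
by move=> h; rewrite ltr_distlC; lra.
Unshelve. all: by end_near. Qed.

(** The gradient inequality, obtained from partial derivatives alone: [K] replaces [psi (x - h v)]
    by its upper bound from [coord_jensen], an average of one-variable functions. Then [K 0 = 0],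
    [K] is nonnegative just right of 0, and its derivative at 0 is the difference of the two
    sides. *)
Lemma convex_first_order (x y : 'rV[R]_n) : cube a l x -> cube a l y ->
  \sum_i 'D_(delta_mx ord0 i) psi x * (y ord0 i - x ord0 i) <= psi y - psi x.
Proof.
move=> Cx Cy; have [n0|n0] := posnP n.
  have -> : y = x by apply/rowP => i; have := ltn_ord i; rewrite {2}n0.
  by rewrite subrr big1// => i _; rewrite subrr mulr0.
have N0 : (n%:R : R) != 0 by rewrite pnatr_eq0 -lt0n.
pose v := y - x.
pose L i h := psi ((0 + (n%:R * - v ord0 i) * (h - 0)) *: e i + x).
pose K h := 0 + (psi y - psi x) * (h - 0) + n%:R^-1 * (\sum_i L i h - n%:R * psi x).
have dL (i : 'I_n) : is_derive (0 : R) 1 (L i) (n%:R * - v ord0 i * 1 * dpsi i x).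
  pose g (h : R) := 0 + (n%:R * - v ord0 i) * (h - 0).
  have g0 : g 0 = 0 by rewrite /g subrr mulr0 addr0.
  have d1 : is_derive (0 : R) 1 g (n%:R * - v ord0 i * 1).
    exact: is_derive_affine.
  have C0 : C (g 0 *: e i + x) by rewrite g0 scale0r add0r.
  have d2 := line_derive i x _ C0.
  have := is_derive1_comp d2 d1.
  by rewrite (_ : g 0 *: e i + x = x) ?g0 ?scale0r ?add0r// mulrC.
have dK : is_derive (0 : R) 1 K ((psi y - psi x) * 1 +
    n%:R^-1 * \sum_i (n%:R * - v ord0 i * 1 * dpsi i x)).
  have d1 := is_derive_affine _ _ 0 (psi y - psi x) 0 _ _ (is_derive_id (0 : R) 1).
  have d2 := is_derive_sum dL.
  have d3 := is_derive_affine _ _ 0 n%:R^-1 (n%:R * psi x) _ _ d2.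
  have := is_deriveD d1 d3.
  apply: near_eq_is_derive; near=> h.
  by rewrite /K /= !fctE fct_sumE; congr (_ + _); rewrite add0r.
have K0 : K 0 = 0.
  have L0 i : L i 0 = psi x by rewrite /L subrr mulr0 addr0 scale0r add0r.
  rewrite /K (eq_bigr (fun=> psi x)); last by move=> i _; exact: L0.
  by rewrite sumr_const card_ord subrr mulr0 !add0r mulr_natl subrr mulr0.
have Kge : \forall h \near 0^'+, 0 <= K h.
  have hC i : \forall h \near (0 : R), C ((0 + (n%:R * - v ord0 i) * (h - 0)) *: e i + x).
    have cg : continuous (fun h : R => 0 + n%:R * - v ord0 i * (h - 0)).
      apply: continuousT_add; first exact: cst_continuous.
      apply: continuousT_scale; apply: continuousT_sub; last exact: cst_continuous.
      by move=> w; exact: cvg_id.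
    by apply: (near_cube_line n a l _ _ _ i) (cg 0) _ Cx; rewrite subrr mulr0 addr0.
  have hC' := @filter_forall _ _ _ (nbhs (0 : R)) _ hC.
  have [d /= d0 hd] := (nbhs_ballP _ _).1 (hC' _).
  near=> h.
  have h0 : 0 < h by near: h; exact: nbhs_right_gt.
  have CL : forall i, C ((0 + (n%:R * - v ord0 i) * (h - 0)) *: e i + x).
    by apply: (hd h); rewrite /ball/= sub0r normrN gtr0_norm.
  have h1 : 0 < 1 + h by rewrite addr_gt0.
  have E0 i : 0 + n%:R * - v ord0 i * (h - 0) = n%:R * (- h *: v) ord0 i.
    by rewrite [in RHS]mxE; ring.
  have [|Cz pz] := coord_jensen x (- h *: v) n0.
    by move=> i; rewrite -E0.
  (* [x] lies between [x - h v] and [y], with weights [1 / (1 + h)] and [h / (1 + h)]. *)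
  have t01 : 0 <= (1 + h)^-1 <= 1.
    by rewrite invr_ge0 ltW//= invf_le1// lerDl ltW.
  have := convpsi _ _ _ t01 Cz Cy.
  have -> : (1 + h)^-1 *: (- h *: v + x) + (1 - (1 + h)^-1) *: y = x.
    by apply/rowP => i; rewrite !mxE; field; rewrite gt_eqF.
  rewrite -(ler_pM2l h1) mulrDr mulrA mulfV ?gt_eqF// mul1r mulrA mulrBr.
  rewrite mulfV ?gt_eqF// mulr1 => pxy.
  have KE : K h = (psi y - psi x) * h +
      n%:R^-1 * (\sum_i psi ((n%:R * (- h *: v) ord0 i) *: e i + x)) - psi x.
    rewrite /K (eq_bigr (fun i => psi ((n%:R * (- h *: v) ord0 i) *: e i + x))).
      by field.
    by move=> i _; rewrite /L E0.
  by rewrite KE; lra.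
suff : 0 <= (psi y - psi x) * 1 + n%:R^-1 * \sum_i (n%:R * - v ord0 i * 1 * dpsi i x).
  rewrite mulr_sumr mulr1.
  rewrite (eq_bigr (fun i => - (dpsi i x * (y ord0 i - x ord0 i)))).
    by rewrite sumrN subr_ge0.
  by move=> i _; rewrite /v !mxE; field.
exact: is_derive_ge0_right dK K0 Kge.
Unshelve. all: by end_near. Qed.

End convex_on_cube.

(** * Continuity of the partial derivatives of a convex function *)

Section potential_on_cube.
Context {R : realType} (n : nat) (a : 'rV[R]_n) (l : R) (psi : 'rV[R]_n -> R).
Context (psi_convex : convex_function (cube a l) psi).
Context (psi_derivable :
  forall i (x : 'rV[R]_n), cube a l x -> derivable psi x (delta_mx ord0 i)).

Let e (i : 'I_n) : 'rV[R]_n := delta_mx ord0 i.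

Let near_shift (x : 'rV[R]_n) i (d : R) : cube a l (d *: e i + x) ->
  nbhs x [set y : 'rV[R]_n | cube a l (d *: e i + y)] /\
  {for x, continuous (fun y => psi (d *: e i + y))}.
Proof.
move=> Cdx.
have cd : {for x, continuous (fun y => d *: e i + y)}.
  by apply: (@continuousD _ _ _ (cst (d *: e i)) id); [exact: cst_continuous|].
split; first by apply: cd; exact: near_cube.
by apply: (continuous_comp cd); exact: convex_continuous.
Qed.

Let shift_first_order (x : 'rV[R]_n) i (d : R) :
  cube a l x -> cube a l (d *: e i + x) ->
  'D_(e i) psi x * d <= psi (d *: e i + x) - psi x.
Proof.
move=> Cx Cdx.
have := @convex_first_order R n a l psi psi_convex psi_derivable x _ Cx Cdx.
rewrite (bigD1 i)//= big1 ?addr0 => [|j ji].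
  by rewrite !mxE !eqxx mulr1 addrK.
by rewrite !mxE (negbTE ji) andbF mulr0 add0r subrr mulr0.
Qed.

(** By convexity the partial derivative at [y] lies between the difference quotients with steps
    [- d] and [d]. For fixed [d] these are continuous in [y], and at [x] both are within [eps] of
    the partial derivative. *)
Lemma partial_continuous i (x : 'rV[R]_n) : cube a l x ->
  {for x, continuous (fun y => 'D_(delta_mx ord0 i) psi y)}.
Proof.
move=> Cx; apply/(@cvgrPdist_lt _ _ _ (nbhs x)) => eps eps0.
have cq : h^-1 *: (psi (h *: e i + x) - psi x) @[h --> 0^'] --> 'D_(e i) psi x.
  exact: psi_derivable.
have hq : \forall h \near 0^',
    `|'D_(e i) psi x - h^-1 *: (psi (h *: e i + x) - psi x)| < eps.
  by move/cvgrPdist_lt : cq; exact.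
have [d1 /= d10 hd1] := (nbhs_ballP _ _).1 hq.
have nl : nbhs (0 : R) [set u : R | cube a l (u *: e i + x)].
  by apply: (near_cube_line n a l R id 0 i x) => //; exact: cvg_id.
have [d2 /= d20 hd2] := (nbhs_ballP _ _).1 nl.
pose d := Num.min d1 d2 / 2.
have m0 : 0 < Num.min d1 d2 by rewrite lt_min d10.
have d0 : 0 < d by rewrite divr_gt0.
have dm : d < Num.min d1 d2 by rewrite /d ltr_pdivrMr// ltr_pMr// ltr1n.
have [dd1 dd2] : d < d1 /\ d < d2 by move: dm; rewrite lt_min => /andP[].
have b1 : ball 0 d1 d by rewrite /ball/= sub0r normrN gtr0_norm.
have b2 : ball 0 d2 d by rewrite /ball/= sub0r normrN gtr0_norm.
have b3 : ball 0 d1 (- d) by rewrite /ball/= sub0r normrN normrN gtr0_norm.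
have b4 : ball 0 d2 (- d) by rewrite /ball/= sub0r normrN normrN gtr0_norm.
have q1 := hd1 d b1 (lt0r_neq0 d0).
have nd0 : - d != 0 by rewrite oppr_eq0 gt_eqF.
have q2 := hd1 (- d) b3 nd0.
have C1 := hd2 _ b2; have C2 := hd2 _ b4.
have [n1 c1] := near_shift x i d C1; have [n2 c2] := near_shift x i (- d) C2.
have cx := convex_continuous n a l psi psi_convex psi_derivable x Cx.
have cq1 : {for x, continuous (fun y => d^-1 * (psi (d *: e i + y) - psi y))}.
  apply: (@continuousM _ _ (cst d^-1) (fun y => psi (d *: e i + y) - psi y)).
    exact: cst_continuous.
  exact: continuousB.
have cq2 : {for x, continuous (fun y => (- d)^-1 * (psi (- d *: e i + y) - psi y))}.
  apply: (@continuousM _ _ (cst (- d)^-1) (fun y => psi (- d *: e i + y) - psi y)).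
    exact: cst_continuous.
  exact: continuousB.
have n3 := near_cube n a l x Cx.
have n4 : nbhs x [set y : 'rV[R]_n |
    d^-1 * (psi (d *: e i + y) - psi y) < 'D_(e i) psi x + eps].
  by apply: (@cvgr_lt _ _ (nbhs x) _ _ _ cq1); move: q1; rewrite ltr_distlC => /andP[].
have n5 : nbhs x [set y : 'rV[R]_n |
    'D_(e i) psi x - eps < (- d)^-1 * (psi (- d *: e i + y) - psi y)].
  by apply: (@cvgr_gt _ _ (nbhs x) _ _ _ cq2); move: q2; rewrite ltr_distlC => /andP[].
apply: (@filterS3 _ (nbhs x) _ _ _ _ _ _ n3 (filterI n1 n2) (filterI n4 n5)).
move=> y Cy [Cy1 Cy2] [/= y4 y5]; rewrite ltr_distlC.
have f1 := shift_first_order y i d Cy Cy1.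
have f2 := shift_first_order y i (- d) Cy Cy2.
apply/andP; split.
- apply: (lt_le_trans y5); rewrite invrN mulNr -mulrN ler_pdivrMl// opprB.
  by move: f2; lra.
- by apply: le_lt_trans y4; rewrite ler_pdivlMl// mulrC.
Qed.

End potential_on_cube.
(** The source of the 8 in [alpha]. The upper Taylor bounds at [s] for [f s1] and [f s2] are
    averaged with weights proportional to [s2 - s] and [s - s1], which cancels the linear term. The
    quadratic term becomes [M / 2 * (s - s1) * (s2 - s)], at most [M * (s2 - s1) ^+ 2 / 8]. *)
Lemma second_derivative_min_le (R : realType) (f f1 f2 : R -> R) (b c M : R) :
  0 <= M ->
  (forall s, b < s < c -> is_derive s 1 f (f1 s)) ->
  (forall s, b < s < c -> is_derive s 1 f1 (f2 s)) ->
  (forall s, b < s < c -> f2 s <= M) ->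
  forall s1 s s2, b < s1 -> s1 <= s -> s <= s2 -> s2 < c ->
  Num.min (f s1) (f s2) <= f s + M * (s2 - s1) ^+ 2 / 8.
Proof.
move=> M0 df df1 f2M s1 s s2 bs1 s1s ss2 s2c.
have bs : b < s by exact: lt_le_trans s1s.
have sc : s < c by exact: le_lt_trans s2c.
have slope u v : b < u -> u <= v -> v < c -> f1 v - f1 u <= M * (v - u).
  move=> bu uv vc.
  have [x||w] := @MVT_segment R f1 f2 u v uv.
  - rewrite in_itv/= => /andP[ux xv]; apply: df1.
    by rewrite (lt_trans bu)//= (lt_trans xv).
  - apply: derivable_within_continuous => x; rewrite in_itv/= => /andP[ux xv].
    by have [] := df1 x; rewrite ?(lt_le_trans bu)//= (le_lt_trans xv).
  - rewrite in_itv/= => /andP[uw wv] ->; rewrite ler_wpM2r ?subr_ge0//.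
    by apply: f2M; rewrite (lt_le_trans bu)//= (le_lt_trans wv).
pose g x := f x - f1 s * (x - s) - M / 2 * (x - s) ^+ 2.
pose dg x := f1 x - f1 s - M * (x - s).
have dgP x : b < x < c -> is_derive x 1 g (dg x).
  move=> /df dfx; pose h (y : R) := 0 + 1 * (y - s).
  have dh : is_derive x 1 h (1 * 1) by exact: is_derive_affine.
  have dk : is_derive x 1 (fun y => 0 + f1 s * (y - s)) (f1 s * 1).
    exact: is_derive_affine.
  have dhh := is_derive_affine _ _ 0 (M / 2) 0 _ _ (is_deriveM dh dh).
  have := is_deriveB (is_deriveB dfx dk) dhh.
  rewrite (_ : _ - _ = dg x); last by rewrite /dg /h /GRing.scale/=; field.
  apply: near_eq_is_derive; near=> y.
  by rewrite /g /h /= !fctE; ring.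
have gs : g s = f s by rewrite /g subrr expr0n/= !mulr0 !subr0.
have cg u v : b < u -> v < c -> {within `[u, v], continuous g}.
  move=> bu vc; apply: derivable_within_continuous => x.
  rewrite in_itv/= => /andP[ux xv].
  by have [] := dgP x; rewrite ?(lt_le_trans bu)//= (le_lt_trans xv).
have g1 : g s1 <= g s.
  have [x|w] := @MVT_segment R g dg s1 s s1s _ (cg _ _ bs1 sc).
    rewrite in_itv/= => /andP[ux xv]; apply: dgP.
    by rewrite (lt_trans bs1)//= (lt_trans xv).
  rewrite in_itv/= => /andP[s1w ws] E; rewrite -subr_ge0 E mulr_ge0 ?subr_ge0//.
  by have := slope w s (lt_le_trans bs1 s1w) ws sc; rewrite /dg; lra.
have g2 : g s2 <= g s.
  have [x|w] := @MVT_segment R g dg s s2 ss2 _ (cg _ _ bs s2c).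
    rewrite in_itv/= => /andP[ux xv]; apply: dgP.
    by rewrite (lt_trans bs)//= (lt_trans xv).
  rewrite in_itv/= => /andP[sw ws2] E; rewrite -subr_le0 E mulr_le0_ge0 ?subr_ge0//.
  by have := slope s w bs sw (le_lt_trans ws2 s2c); rewrite /dg; lra.
move: g1 g2; rewrite gs /g => g1 g2.
rewrite leNgt lt_min; apply/negP => /andP[h1 h2].
set k := f s + _ in h1 h2.
(* If both values exceeded [k], so would their average. The case [s1 = s = s2], where both weights
   vanish, is excluded by [h1] itself. *)
have pq : 0 < (s2 - s) * (f s1 - k) + (s - s1) * (f s2 - k).
  move: s1s; rewrite le_eqVlt => /predU1P[s1E|s1s].
    move: ss2; rewrite le_eqVlt => /predU1P[s2E|ss2].
      by move: h1; rewrite /k -s2E s1E subrr expr0n/= mulr0 mul0r addr0 ltxx.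
    by rewrite -s1E subrr mul0r addr0 mulr_gt0// subr_gt0 // s1E.
  by rewrite ltr_wpDl ?mulr_ge0 ?mulr_gt0 ?subr_ge0 ?subr_gt0// ltW.
have e1 : (s2 - s) * (f s1 - k) <= (s2 - s) *
    (f1 s * (s1 - s) + M / 2 * (s1 - s) ^+ 2 - M * (s2 - s1) ^+ 2 / 8).
  by rewrite ler_wpM2l ?subr_ge0// /k; lra.
have e2 : (s - s1) * (f s2 - k) <= (s - s1) *
    (f1 s * (s2 - s) + M / 2 * (s2 - s) ^+ 2 - M * (s2 - s1) ^+ 2 / 8).
  by rewrite ler_wpM2l ?subr_ge0// /k; lra.
have := lt_le_trans pq (lerD e1 e2).
rewrite [ltRHS](_ : _ = - (M * (s2 - s1) * (s1 + s2 - 2 * s) ^+ 2 / 8)).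
  rewrite oppr_gt0 ltNge divr_ge0// mulr_ge0 ?sqr_ge0// mulr_ge0// subr_ge0.
  exact: le_trans ss2.
by field.
Unshelve. all: by end_near. Qed.

(** * Squared Euclidean distances to points and sets *)

Section euclidean_distance.
Context {R : realType} {n : nat}.
Implicit Types (x y z : 'rV[R]_n) (A : set 'rV[R]_n).

Definition sqdist x y : R := \sum_i (x ord0 i - y ord0 i) ^+ 2.

Definition sqdist_to A x : R := inf [set sqdist x y | y in A].

Lemma sqdist_ge0 x y : 0 <= sqdist x y.
Proof. by apply: sumr_ge0 => i _; exact: sqr_ge0. Qed.

Lemma sqdist_xx x : sqdist x x = 0.
Proof. by rewrite /sqdist big1// => i _; rewrite subrr expr0n. Qed.

Lemma sqdistC x y : sqdist x y = sqdist y x.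
Proof. by apply: eq_bigr => i _; ring. Qed.

(** A triangle inequality for squares: in each coordinate the two sides differ by a square divided
    by [d]. It is used with [d = 1] and [d = 8], and with small [d] for continuity. *)
Lemma sqdist_weighted (d : R) x y z : 0 < d ->
  sqdist x z <= (1 + d) * sqdist y z + (1 + d^-1) * sqdist x y.
Proof.
move=> d0; rewrite /sqdist !mulr_sumr -big_split/=; apply: ler_sum => i _.
set u := x ord0 i; set v := y ord0 i; set w := z ord0 i.
rewrite -subr_ge0 [leRHS](_ : _ = (d * (v - w) - (u - v)) ^+ 2 / d).
  by rewrite divr_ge0 ?sqr_ge0// ltW.
by field; rewrite gt_eqF.
Qed.

Lemma sqdist_to_le A x y : A y -> sqdist_to A x <= sqdist x y.
Proof.
move=> Ay; apply: ge_inf; last by exists y.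
by exists 0 => _ [z _ <-]; exact: sqdist_ge0.
Qed.

Lemma sqdist_to_ge A x (k : R) : A !=set0 ->
  (forall y, A y -> k <= sqdist x y) -> k <= sqdist_to A x.
Proof.
move=> [y Ay] kA; apply: lb_le_inf; first by exists (sqdist x y); exists y.
by move=> _ [z Az <-]; exact: kA.
Qed.

Lemma sqdist_to_ge0 A x : A !=set0 -> 0 <= sqdist_to A x.
Proof. by move=> A0; apply: sqdist_to_ge => // y _; exact: sqdist_ge0. Qed.

Lemma sqdist_to_eq0 A x : A x -> sqdist_to A x = 0.
Proof.
move=> Ax; apply/eqP; rewrite eq_le sqdist_to_ge0 ?andbT; last by exists x.
by rewrite -(sqdist_xx x); exact: sqdist_to_le.
Qed.

Lemma sqdist_to_weighted A (d : R) x y : A !=set0 -> 0 < d ->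
  sqdist_to A x <= (1 + d) * sqdist_to A y + (1 + d^-1) * sqdist x y.
Proof.
move=> A0 d0; have d1 : 0 < 1 + d by rewrite addr_gt0.
rewrite -lerBlDr [leRHS]mulrC -ler_pdivrMr//.
apply: sqdist_to_ge => // z Az; rewrite ler_pdivrMr// [leRHS]mulrC lerBlDr.
by apply: le_trans (sqdist_weighted d x y z d0); exact: sqdist_to_le.
Qed.

Lemma continuous_sqdist x : continuous (sqdist x).
Proof.
have ci i : continuous (fun y : 'rV[R]_n => (x ord0 i - y ord0 i) ^+ 2).
  have cb : continuous (fun y : 'rV[R]_n => x ord0 i - y ord0 i).
    apply: continuousT_sub; first exact: cst_continuous.
    by move=> y; exact: coord_continuous.
  exact: (continuousT_mul _ _ cb cb).
have ca : continuous (fun u : R * R => u.1 + u.2) by exact: add_continuous.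
exact: (@continuous_big R 'I_n +%R 0 xpredT ca _ _
  (fun i (y : 'rV[R]_n) => (x ord0 i - y ord0 i) ^+ 2) (fun i _ => ci i)).
Qed.

Lemma continuous_sqdist_to A : A !=set0 -> continuous (sqdist_to A).
Proof.
move=> A0 x; apply/(@cvgrPdist_lt _ _ _ (nbhs x)) => eps eps0.
have e1 : 0 < sqdist_to A x + 1 by rewrite ltr_wpDl// sqdist_to_ge0.
(* With this [d] the multiplicative error [d * sqdist_to A x] is at most [eps / 2]; [y] is then
   taken so close to [x] that the other error term is below [eps / 2]. *)
pose d := eps / 2 / (sqdist_to A x + 1).
have d0 : 0 < d by rewrite !divr_gt0.
have k0 : 0 < 1 + d^-1 by rewrite addr_gt0// invr_gt0.
have dE : d * sqdist_to A x <= eps / 2.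
  rewrite /d mulrAC ler_pdivrMr// ler_pM2l ?divr_gt0// lerDl//.
have h : nbhs x [set y | sqdist x y < eps / 2 / (1 + d^-1)].
  apply: (@cvgr_lt _ _ (nbhs x) _ _ _ (continuous_sqdist x x)).
  by rewrite sqdist_xx !divr_gt0.
apply: (@filterS _ (nbhs x) _ _ _ _ h) => y /=.
rewrite ltr_pdivlMr// mulrC => hy.
have h1 := sqdist_to_weighted A d x y A0 d0.
have h2 := sqdist_to_weighted A d y x A0 d0; rewrite sqdistC in h2.
rewrite ltr_distlC; apply/andP; split; last by lra.
have [yx|xy] := leP (sqdist_to A y) (sqdist_to A x); last by lra.
have : d * sqdist_to A y <= d * sqdist_to A x by rewrite ler_pM2l.
by lra.
Qed.

End euclidean_distance.

(** * Projection onto a closed cube *)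

Section clamp_box.
Context {R : realType} {n : nat}.

Definition clamp_rV (b : 'rV[R]_n) (l : R) (x : 'rV[R]_n) : 'rV[R]_n :=
  \row_i clamp (b ord0 i) (b ord0 i + l) (x ord0 i).

Lemma clamp_rV_continuous b l : continuous (clamp_rV b l).
Proof.
apply: continuous_rV => i.
have -> : (fun x => clamp_rV b l x ord0 i) =
    clamp (b ord0 i) (b ord0 i + l) \o (fun x : 'rV[R]_n => x ord0 i).
  by apply/funext => x; rewrite mxE.
by apply: continuousT_comp; [move=> x; exact: coord_continuous|exact: clamp_continuous].
Qed.

Lemma clamp_rV_id b l x : closed_box n b l x -> clamp_rV b l x = x.
Proof. by move=> xb; apply/rowP => i; rewrite mxE clamp_id. Qed.

Lemma clamp_rV_box b l x : 0 <= l -> closed_box n b l (clamp_rV b l x).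
Proof. by move=> l0 i; rewrite mxE clamp_itv// lerDl. Qed.

End clamp_box.

(** * The product inequality on closed cubes inside the open cube *)

Section inner_box.
Context {R : realType} (n : nat) (l M : R) (a : 'rV[R]_n) (psi : 'rV[R]_n -> R).
Context (l0 : 0 < l) (M0 : 0 <= M).
Context (psi_convex : convex_function (cube a l) psi).
Context (psi2 : forall (i : 'I_n) (x : 'rV[R]_n), cube a l x ->
    let e : 'rV[R]_n := delta_mx ord0 i in
    [/\ derivable psi x e, derivable ('D_e psi) x e & 'D_e ('D_e psi) x <= M]).
Context (eps : R) (eps0 : 0 < eps) (epsl : 0 < l - 2 * eps).

Definition inner_corner : 'rV[R]_n := a + const_mx eps.
Let b := inner_corner.
Let L := l - 2 * eps.

Let bE i : b ord0 i = a ord0 i + eps. Proof. by rewrite !mxE. Qed.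

Lemma inner_box_cube x : closed_box n b L x -> cube a l x.
Proof.
move=> xb; apply/cubeP => i; have := xb i; rewrite bE /L.
by move: eps0; lra.
Qed.

Let psi1 i (x : 'rV[R]_n) : cube a l x -> derivable psi x (delta_mx ord0 i).
Proof. by move=> Cx; have [] := psi2 i x Cx. Qed.

(* Precomposing with the projection onto a closed cube inside [cube a l] makes the
   density continuous everywhere without changing it on the closed cube. *)
Definition inner_density (x : 'rV[R]_n) : R := expR (- psi (clamp_rV b L x)).
Let r := inner_density.

Let Vcube x : cube a l (clamp_rV b L x).
Proof. by apply/inner_box_cube/clamp_rV_box/ltW. Qed.

Let cont_clamp (f : 'rV[R]_n -> R) :
  (forall x : 'rV[R]_n, cube a l x -> {for x, continuous f}) ->
  continuous (fun x => f (clamp_rV b L x)).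
Proof.
move=> cf x; apply: (continuous_comp (clamp_rV_continuous b L x)).
exact/cf/Vcube.
Qed.

Lemma inner_density_gt0 x : 0 < r x. Proof. exact: expR_gt0. Qed.

Lemma inner_densityE x : closed_box n b L x -> r x = expR (- psi x).
Proof. by move=> xb; rewrite /r /inner_density clamp_rV_id. Qed.

Lemma inner_density_continuous : continuous r.
Proof.
have cpsi := cont_clamp psi (convex_continuous n a l psi psi_convex psi1).
move=> x; apply: (continuous_comp (f := fun x => - psi (clamp_rV b L x))).
  by apply: continuousN; exact: cpsi.
exact: continuous_expR.
Qed.

Let kap := expR (M * l ^+ 2 / 8).
(** The largest value with [2 * c * kap * l ^+ 2 <= 1]; using [l] instead of [L] makes it
    independent of [eps]. *)
Let c := (2 * l ^+ 2 * kap)^-1.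

Let upd_line (x : 'rV[R]_n) i s :
  upd n x i s = s *: delta_mx ord0 i + upd n x i 0.
Proof.
apply/rowP => j; rewrite !mxE eqxx/=; case: (j =P i) => _.
  by rewrite mulr1 addr0.
by rewrite mulr0 add0r.
Qed.

Let upd_cube (x : 'rV[R]_n) i s : cube a l x -> a ord0 i < s < a ord0 i + l ->
  cube a l (upd n x i s).
Proof.
move=> /cubeP Cx sa; apply/cubeP => j; rewrite mxE; case: (j =P i) => [->//|_].
exact: Cx.
Qed.

Let upd_box (x : 'rV[R]_n) i s : closed_box n b L x ->
  b ord0 i <= s <= b ord0 i + L -> closed_box n b L (upd n x i s).
Proof.
move=> xb sb j; rewrite [upd _ _ _ _ _ _]mxE; case: (j =P i) => [->//|_]; exact: xb.
Qed.

Let line_derivative (f : 'rV[R]_n -> R) (x : 'rV[R]_n) i s :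
  derivable f (upd n x i s) (delta_mx ord0 i) ->
  is_derive s 1 (fun u => f (upd n x i u)) ('D_(delta_mx ord0 i) f (upd n x i s)).
Proof.
rewrite upd_line => /is_derive_line.
by rewrite (_ : (fun u : R => f (upd n x i u)) =
  (fun u : R => f (u *: delta_mx ord0 i + upd n x i 0)))//;
  apply/funext => u; rewrite upd_line.
Qed.

(** Inside the closed cube this is the [i]-th partial derivative of [r]; the clamping again provides
    continuity everywhere. *)
Let p i (x : 'rV[R]_n) : R :=
  - 'D_(delta_mx ord0 i) psi (clamp_rV b L x) * r x.

Let inner_derive i x s : closed_box n b L x -> b ord0 i < s < b ord0 i + L ->
  is_derive s 1 (fun u => r (upd n x i u)) (p i (upd n x i s)).
Proof.
move=> xb sb.
have sb' : b ord0 i <= s <= b ord0 i + L by case/andP: sb => /ltW-> /ltW.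
have ub := upd_box x i s xb sb'.
have d1 := line_derivative psi x i s (psi1 i _ (inner_box_cube _ ub)).
pose g u := - psi (upd n x i u).
have dg : is_derive s 1 g (- 'D_(delta_mx ord0 i) psi (upd n x i s)).
  exact: is_deriveN d1.
have d2 := is_derive1_comp (is_derive_expR (g s)) dg.
have -> : p i (upd n x i s) = expR (- psi (upd n x i s)) *
    - 'D_(delta_mx ord0 i) psi (upd n x i s).
  by rewrite /p inner_densityE// clamp_rV_id// mulrC.
apply: near_eq_is_derive d2; near=> u.
have ub' : closed_box n b L (upd n x i u).
  apply: upd_box => //.
  suff: u \in `]b ord0 i, b ord0 i + L[ by rewrite in_itv/= => /andP[/ltW-> /ltW].
  by near: u; apply: near_in_itvoo; rewrite in_itv.
by rewrite inner_densityE.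
Unshelve. all: by end_near. Qed.

(** At one of the two outer points [psi] exceeds its value at [s] by at most [M * l ^+ 2 / 8], by
    [second_derivative_min_le]. There [kap] times the density dominates, and the other summand is
    positive. *)
Let inner_peak i x s1 s s2 : closed_box n b L x -> b ord0 i <= s1 -> s1 <= s ->
  s <= s2 -> s2 <= b ord0 i + L ->
  r (upd n x i s) <= kap * (r (upd n x i s1) + r (upd n x i s2)).
Proof.
move=> xb bs1 s1s ss2 s2b.
have ub u : s1 <= u <= s2 -> closed_box n b L (upd n x i u).
  by move=> /andP[u1 u2]; apply: upd_box; rewrite // (le_trans bs1)//= (le_trans u2).
pose f u := psi (upd n x i u).
pose D1 := 'D_(delta_mx ord0 i) psi.
have := @second_derivative_min_le R f (fun u => D1 (upd n x i u))
  (fun u => 'D_(delta_mx ord0 i) D1 (upd n x i u))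
  (a ord0 i) (a ord0 i + l) M M0 _ _ _ s1 s s2 _ s1s ss2 _.
have xC := inner_box_cube x xb.
move=> h.
have {h}hmin : Num.min (f s1) (f s2) <= f s + M * (s2 - s1) ^+ 2 / 8.
  apply: h.
  - move=> u ua; apply: line_derivative; apply: psi1; exact: upd_cube.
  - move=> u ua; apply: line_derivative.
    by have [] := psi2 i _ (upd_cube x i u xC ua).
  - by move=> u ua; have [] := psi2 i _ (upd_cube x i u xC ua).
  - by apply: lt_le_trans bs1; rewrite bE ltrDl.
  - by apply: (le_lt_trans s2b); rewrite bE /L; move: eps0; lra.
have s1s2 : s1 <= s2 by exact: le_trans ss2.
have s12 : (s2 - s1) ^+ 2 <= l ^+ 2.
  rewrite ler_sqr ?nnegrE ?subr_ge0 ?(ltW l0)//.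
  by move: eps0 s2b bs1; rewrite /L; lra.
have hmin' : Num.min (f s1) (f s2) <= f s + M * l ^+ 2 / 8.
  by apply: (le_trans hmin); rewrite lerD2l ler_pM2r// ler_wpM2l.
have rE u : s1 <= u <= s2 -> r (upd n x i u) = expR (- f u).
  by move=> /ub; exact: inner_densityE.
rewrite !rE ?lexx ?s1s ?s1s2//.
have key u : f u <= f s + M * l ^+ 2 / 8 -> expR (- f s) <= kap * expR (- f u).
  by move=> h; rewrite /kap -expRD ler_expR; lra.
move: hmin'; rewrite ge_min => /orP[/key|/key] h; apply: (le_trans h).
  by rewrite ler_pM2l ?expR_gt0// lerDl expR_ge0.
by rewrite ler_pM2l ?expR_gt0// lerDr expR_ge0.
Qed.

(* The constants [8 c] and [8 c / 9] satisfy
   [8/9 (u + v)^2 <= 8 u^2 + v^2], i.e. [sqdist_to_weighted] with [d = 8]. *)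
Lemma inner_transport (A : set 'rV[R]_n) : A !=set0 ->
  itgn n b L r * (ln (itgn n b L (fun x => expR (- (8 * c) * sqdist_to A x) * r x))
    - ln (itgn n b L r)) <=
  itgn n b L (fun x => - (8 / 9 * c) * sqdist_to A x * r x).
Proof.
move=> A0.
have c0 : 0 < c by rewrite invr_gt0 !mulr_gt0 ?expR_gt0 ?exprn_gt0.
have cE := continuous_sqdist_to A A0.
have cr := inner_density_continuous.
have cexp : continuous (fun x => expR (- (8 * c) * sqdist_to A x)).
  have cl := continuousT_scale (- (8 * c)) _ cE.
  by move=> x; apply: (continuous_comp (cl x)); exact: continuous_expR.
apply: (@transport_inequality R n b L kap c r _ _ p) => //.
- exact: expR_ge0.
- exact: ltW.
- rewrite (_ : 2 * c * kap * L ^+ 2 = (L / l) ^+ 2); last first.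
    by rewrite /c; field; rewrite !gt_eqF// expR_gt0.
  apply: exprn_ile1; first by rewrite divr_ge0 ?(ltW l0) ?(ltW epsl).
  by rewrite ler_pdivrMr// mul1r /L gerBl mulr_ge0 ?(ltW eps0).
- exact: (continuousT_mul _ _ cexp cr).
- exact: (continuousT_mul _ _ (continuousT_scale (- (8 / 9 * c)) _ cE) cr).
- move=> i; apply: continuousT_mul => //.
  have cp := cont_clamp _ (partial_continuous n a l psi psi_convex psi1 i).
  exact: continuousT_opp cp.
- exact: inner_density_gt0.
- by move=> x; rewrite mulr_gt0 ?expR_gt0// inner_density_gt0.
move=> x y xb yb; rewrite /p !inner_densityE// clamp_rV_id//.
rewrite lnM ?posrE ?expR_gt0// !expRK.
set rx := expR (- psi x).
have rx0 : 0 < rx by exact: expR_gt0.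
have -> : \sum_i - 'D_(delta_mx ord0 i) psi x * rx * (y ord0 i - x ord0 i) =
    - rx * \sum_i 'D_(delta_mx ord0 i) psi x * (y ord0 i - x ord0 i).
  by rewrite mulr_sumr; apply: eq_bigr => i _; ring.
have := convex_first_order n a l psi psi_convex psi1 x y
  (inner_box_cube x xb) (inner_box_cube y yb).
set S := \sum_i _ => first.
have w8 := sqdist_to_weighted A 8 x y A0 (ltr0n _ 8).
rewrite -/(sqdist x y).
(* After factoring out [rx], what remains is the first-order convexity inequality plus [c] times the
   weighted triangle inequality. *)
rewrite -subr_ge0 [leRHS](_ : _ = rx * (psi y - psi x - S +
  c * (8 * sqdist_to A y + sqdist x y - 8 / 9 * sqdist_to A x))); last by ring.
rewrite mulr_ge0 ?(ltW rx0)// addr_ge0 ?subr_ge0//.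
by rewrite mulr_ge0 ?(ltW c0)//; move: w8; lra.
Qed.

Lemma inner_transport_pair (A B : set 'rV[R]_n) (t : R) :
  A !=set0 -> B !=set0 -> (forall x y, A x -> B y -> t ^+ 2 <= sqdist x y) ->
  itgn n b L (fun x => expR (- (8 * c) * sqdist_to A x) * r x) *
  itgn n b L (fun x => expR (- (8 * c) * sqdist_to B x) * r x) <=
  itgn n b L r ^+ 2 * expR (- (4 / 9 * c * t ^+ 2)).
Proof.
move=> A0 B0 AB.
have c0 : 0 < c by rewrite invr_gt0 !mulr_gt0 ?expR_gt0 ?exprn_gt0.
have cr := inner_density_continuous.
have L0 : 0 <= L by exact: ltW.
have cw (S : set 'rV[R]_n) (k : R) : S !=set0 ->
    continuous (fun x => expR (k * sqdist_to S x) * r x).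
  move=> S0; apply: continuousT_mul => //.
  have cl := continuousT_scale k _ (continuous_sqdist_to S S0).
  by move=> x; apply: (continuous_comp (cl x)); exact: continuous_expR.
have cm (S : set 'rV[R]_n) (k : R) : S !=set0 ->
    continuous (fun x => k * sqdist_to S x * r x).
  move=> S0; apply: continuousT_mul => //; apply: continuousT_scale.
  exact: continuous_sqdist_to.
have w0 (S : set 'rV[R]_n) k : S !=set0 ->
    0 < itgn n b L (fun x => expR (k * sqdist_to S x) * r x).
  move=> S0; apply: itgn_gt0 => //; first exact: cw.
  by move=> x _; rewrite mulr_gt0 ?expR_gt0// inner_density_gt0.
have Z0 : 0 < itgn n b L r.
  by apply: itgn_gt0 => // x _; exact: inner_density_gt0.
(* The weighted inequality with [d = 1], through [x], for a point of [A] and a point of [B]. *)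
have half x : t ^+ 2 / 2 <= sqdist_to A x + sqdist_to B x.
  rewrite -lerBlDr; apply: sqdist_to_ge => // y Ay.
  rewrite lerBlDr -lerBlDl; apply: sqdist_to_ge => // z Bz.
  have := sqdist_weighted 1 y x z ltr01.
  rewrite invr1 (sqdistC y x) => h; have := AB y z Ay Bz.
  by rewrite lerBlDl; move: h; lra.
have := lerD (inner_transport A A0) (inner_transport B B0).
set I1 := itgn n b L _ in Z0 *; set IA := itgn n b L _; set IB := itgn n b L _.
rewrite -itgnD//; [|exact: cm..].
have IA0 : 0 < IA by exact: w0.
have IB0 : 0 < IB by exact: w0.
set J := itgn n b L _ => hJ.
(* The constant [4 / 9] is [8 / 9] from each transport inequality times [1 / 2] from [half]. *)
have : J <= - (4 / 9 * c * t ^+ 2) * I1.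
  rewrite -itgnZ//; apply: le_itgn => //.
  - by apply: continuousT_add; exact: cm.
  - exact: continuousT_scale.
  move=> x _; rewrite -mulrDl ler_wpM2r ?(ltW (inner_density_gt0 x))//.
  rewrite -mulrDr mulNr lerN2.
  by have := ler_wpM2l (ltW c0) (half x); lra.
move=> /(le_trans hJ); rewrite -mulrDr mulrC ler_pM2r// => h.
rewrite -[leLHS]lnK ?posrE ?mulr_gt0// -[I1 ^+ 2]lnK ?posrE ?exprn_gt0//.
by rewrite -expRD ler_expR lnM ?posrE// lnXn//; move: h; lra.
Qed.

Context (mu : probability (borel_rV R n) R).
Context (mu_density : forall B : set (borel_rV R n), measurable B ->
  (mu B = \int[lebesgue_rV R n]_(x in B `&` cube a l) (expR (- psi x))%:E)%E).

Let box : set (borel_rV R n) := closed_box n b L.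

Let mbox : measurable box. Proof. exact: measurable_closed_box. Qed.

Let inner_mass (A : set (borel_rV R n)) : measurable A ->
  (mu (A `&` box) = \int[lebesgue_rV R n]_(x in A `&` box) (r x)%:E)%E.
Proof.
move=> mA; rewrite mu_density; last exact: measurableI.
rewrite setIidl; last by move=> x [_ xb]; exact: inner_box_cube.
by apply: eq_integral => x; rewrite inE => -[_ xb]; rewrite inner_densityE.
Qed.

Lemma inner_mass_box : mu box = (itgn n b L r)%:E.
Proof.
rewrite -[box]setTI inner_mass// setTI; apply: integral_closed_box.
- exact: ltW.
- exact: inner_density_continuous.
- by move=> x; exact/ltW/inner_density_gt0.
Qed.

(** The weight equals 1 on [A], where the distance vanishes, and the integrand is nonnegative on the
    rest of the box. *)
Lemma inner_mass_le (A : set (borel_rV R n)) (k : R) : measurable A ->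
  A !=set0 -> (mu (A `&` box) <=
    (itgn n b L (fun x => expR (k * sqdist_to (A : set 'rV[R]_n) x) * r x))%:E)%E.
Proof.
move=> mA A0; rewrite inner_mass//.
have cw : continuous (fun x : 'rV[R]_n =>
    expR (k * sqdist_to (A : set 'rV[R]_n) x) * r x).
  apply: continuousT_mul; last exact: inner_density_continuous.
  have cl := continuousT_scale k _ (continuous_sqdist_to (A : set 'rV[R]_n) A0).
  by move=> x; apply: (continuous_comp (cl x)); exact: continuous_expR.
have w0 (x : 'rV[R]_n) : 0 <= expR (k * sqdist_to (A : set 'rV[R]_n) x) * r x.
  by rewrite mulr_ge0 ?expR_ge0// ltW// inner_density_gt0.
rewrite -integral_closed_box//; last exact: ltW.
rewrite (eq_integral (fun x : borel_rV R n =>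
    (expR (k * sqdist_to (A : set 'rV[R]_n) x) * r x)%:E)); last first.
  move=> x; rewrite inE => -[Ax _].
  by rewrite sqdist_to_eq0// mulr0 expR0 mul1r.
apply: ge0_subset_integral => //; first exact: measurableI.
- apply/measurable_EFinP; apply: measurable_funTS.
  exact: (measurable_continuous_rV _ _ cw).
- by move=> x _; rewrite lee_fin.
Qed.

Lemma inner_mass_product (A B : set (borel_rV R n)) (t : R) :
  measurable A -> measurable B ->
  (forall x y : 'rV[R]_n, A x -> B y -> t ^+ 2 <= sqdist x y) ->
  (mu (A `&` box) * mu (B `&` box) <= (expR (- (4 / 9 * c * t ^+ 2)))%:E)%E.
Proof.
move=> mA mB AB.
have [->|/set0P A0] := eqVneq A set0.
  by rewrite set0I measure0 mul0e lee_fin expR_ge0.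
have [->|/set0P B0] := eqVneq B set0.
  by rewrite set0I measure0 mule0 lee_fin expR_ge0.
apply: (le_trans (lee_pmul _ _ (inner_mass_le A (- (8 * c)) mA A0)
  (inner_mass_le B (- (8 * c)) mB B0))) => //.
rewrite -EFinM lee_fin; apply: (le_trans (inner_transport_pair A B t A0 B0 AB)).
rewrite ler_piMl ?expR_ge0//.
have Z1 : itgn n b L r <= 1.
  by rewrite -lee_fin -inner_mass_box; exact: probability_le1.
have Z0 : 0 <= itgn n b L r by rewrite -lee_fin -inner_mass_box.
exact: exprn_ile1.
Qed.

End inner_box.

(** * Exhaustion of the open cube by closed cubes *)

Section cube_exhaustion.
Context {R : realType} (n : nat) (l M : R) (a : 'rV[R]_n) (psi : 'rV[R]_n -> R).
Context (mu : probability (borel_rV R n) R).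
Context (l0 : 0 < l) (M0 : 0 <= M).
Context (psi_convex : convex_function (cube a l) psi).
Context (mu_density : forall B : set (borel_rV R n), measurable B ->
  (mu B = \int[lebesgue_rV R n]_(x in B `&` cube a l) (expR (- psi x))%:E)%E).
Context (psi2 : forall (i : 'I_n) (x : 'rV[R]_n), cube a l x ->
    let e : 'rV[R]_n := delta_mx ord0 i in
    [/\ derivable psi x e, derivable ('D_e psi) x e & 'D_e ('D_e psi) x <= M]).

(** The offset 3 ensures [2 * eps k < l] already for [k = 0]. *)
Let eps k : R := l / k.+3%:R.

Let box k : set (borel_rV R n) :=
  closed_box n (inner_corner n a (eps k)) (l - 2 * eps k).

Let eps0 k : 0 < eps k. Proof. by rewrite divr_gt0. Qed.

Let epsl k : 0 < l - 2 * eps k.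
Proof.
rewrite subr_gt0 /eps mulrCA -[ltRHS]mulr1 ltr_pM2l// ltr_pdivrMr// mul1r.
by rewrite ltr_nat.
Qed.

Let boxP k (x : 'rV[R]_n) : box k x <->
  forall i, a ord0 i + eps k <= x ord0 i <= a ord0 i + l - eps k.
Proof.
by split=> xb i; have := xb i; rewrite ?mxE => /andP[x1 x2]; apply/andP; split=> //;
  move: x1 x2; rewrite ?mxE; lra.
Qed.

Let box_nondecreasing : nondecreasing_seq box.
Proof.
move=> j k jk; apply/subsetPset => x /boxP xj; apply/boxP => i.
have : eps k <= eps j by rewrite ler_pM2l// lef_pV2 ?posrE// ler_nat.
by have := xj i; lra.
Qed.

Let bigcup_box : \bigcup_k box k = cube a l.
Proof.
apply/seteqP; split=> [x [k _ xk]|x /cubeP Cx].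
  exact: (inner_box_cube n l a (eps k) (eps0 k)).
have near_i i : \forall k \near \oo,
    a ord0 i + eps k <= x ord0 i <= a ord0 i + l - eps k.
  pose d := Num.min (x ord0 i - a ord0 i) (a ord0 i + l - x ord0 i).
  have d0 : 0 < d / l.
    by rewrite divr_gt0// lt_min !subr_gt0; have /andP[-> ->] := Cx i.
  apply: filterS (near_infty_natSinv_lt (PosNum d0)) => k /= kd.
  have : eps k <= d.
    rewrite /eps -ler_pdivlMl// mulrC; apply/ltW/(le_lt_trans _ kd).
    by rewrite lef_pV2 ?posrE// ler_nat; do 2 apply: leqW.
  by rewrite le_min => /andP[]; lra.
have near_all := @filter_forall _ _ _ _ _ near_i.
near \oo => k; exists k => //; apply/boxP => i.
by move: i; near: k; exact: near_all.
Unshelve. all: by end_near. Qed.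

(** The density formula gives [A] and its trace on the cube the same mass; continuity from below
    along the increasing boxes does the rest. *)
Let mass_cvg (A : set (borel_rV R n)) : measurable A ->
  fine (mu (A `&` box k)) @[k --> \oo] --> fine (mu A).
Proof.
move=> mA.
have mbox k : measurable (box k) by exact: measurable_closed_box.
have mcube : measurable (cube a l) by exact: measurable_open_box.
have -> : mu A = mu (\bigcup_k (A `&` box k)).
  rewrite -setI_bigcupr bigcup_box !mu_density//; last exact: measurableI.
  by rewrite -setIA setIid.
apply: fine_cvg; rewrite fineK ?fin_num_measure//; last first.
  by apply: bigcupT_measurable => k; exact: measurableI.
apply: nondecreasing_cvg_mu => [k||].
- exact: measurableI.
- by apply: bigcupT_measurable => k; exact: measurableI.
- move=> j k jk; apply/subsetPset; apply: setIS.
  exact/subsetPset/box_nondecreasing.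
Qed.

Lemma mass_product (A B : set (borel_rV R n)) (t : R) :
  measurable A -> measurable B ->
  (forall x y : 'rV[R]_n, A x -> B y -> t ^+ 2 <= sqdist x y) ->
  fine (mu A) * fine (mu B) <=
  expR (- (4 / 9 * (2 * l ^+ 2 * expR (M * l ^+ 2 / 8))^-1 * t ^+ 2)).
Proof.
move=> mA mB AB.
have cv : fine (mu (A `&` box k)) * fine (mu (B `&` box k)) @[k --> \oo] -->
    fine (mu A) * fine (mu B).
  exact: (cvgM (mass_cvg A mA) (mass_cvg B mB)).
apply: (cvgr_to_le cv); near=> k.
have mbox : measurable (box k) by exact: measurable_closed_box.
rewrite -fineM ?fin_num_measure//; try exact: measurableI.
rewrite -lee_fin fineK; last first.
  by rewrite fin_numM// fin_num_measure//; exact: measurableI.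
exact: (inner_mass_product n l M a psi l0 M0 psi_convex psi2 (eps k) (eps0 k)
  (epsl k) mu mu_density A B t mA mB AB).
Unshelve. all: by end_near. Qed.

End cube_exhaustion.

(** * Open thickenings and the concentration bound *)

Lemma open_thickening_sub (R : realType) n (A : set 'rV[R]_n) (t : R) : 0 < t ->
  [set x | exists2 y, A y & sqdist y x < t ^+ 2] `<=` thickening A t.
Proof.
move=> t0 x [y Ay yx]; exists y => //; exists (t^-1 *: (x - y)); last first.
  by rewrite scalerA mulfV ?gt_eqF// scale1r addrC subrK.
rewrite /euclid_ball /= /euclid_norm -[leRHS]sqrtr1 ler_wsqrtr//.
rewrite (eq_bigr (fun i => t ^- 2 * (y ord0 i - x ord0 i) ^+ 2)); last first.
  by move=> i _; rewrite !mxE; field; rewrite gt_eqF.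
rewrite -mulr_sumr -/(sqdist y x) mulrC ler_pdivrMr ?exprn_gt0// mul1r.
exact: ltW.
Qed.

Lemma open_thickening_open (R : realType) n (A : set 'rV[R]_n) (t : R) :
  open [set x | exists2 y, A y & sqdist y x < t ^+ 2].
Proof.
have -> : [set x | exists2 y, A y & sqdist y x < t ^+ 2] =
    \bigcup_(y in A) (sqdist y @^-1` [set u | u < t ^+ 2]).
  by apply/seteqP; split=> [x [y Ay yx]|x [y Ay yx]]; exists y.
apply: bigcup_open => y _; apply: open_comp; last exact: open_lt.
by move=> x _; exact: continuous_sqdist.
Qed.


Theorem theorem1p1 (R : realType) (n : nat) (l M : R) (a : 'rV[R]_n)
    (psi : 'rV[R]_n -> R) (mu : probability (borel_rV R n) R)
    (A : set (borel_rV R n)) :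
  0 < l -> 0 <= M ->
  convex_function (cube a l) psi ->
  (forall B : set (borel_rV R n), measurable B ->
    mu B = \int[lebesgue_rV R n]_(x in B `&` cube a l) (expR (- psi x))%:E)%E ->
  (forall (i : 'I_n) (x : 'rV[R]_n), cube a l x ->
    let e : 'rV[R]_n := delta_mx ord0 i in
    [/\ derivable psi x e, derivable ('D_e psi) x e & 'D_e ('D_e psi) x <= M]) ->
  measurable A -> ((2^-1)%:E <= mu A)%E ->
  forall t : R, 0 < t ->
  ((1 - expR (- (t ^+ 2 / alpha l M ^+ 2)))%:E
    <= inner_measure mu (thickening A t))%E.
Proof.
move=> l0 M0 psi_convex mu_density psi2 mA A2 t t0.
(* The open thickening is Borel and contained in [thickening A t], so its mass bounds the inner
   measure from below. *)
pose E : set (borel_rV R n) :=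
  [set x | exists2 y, A y & sqdist (y : 'rV[R]_n) x < t ^+ 2].
have mE : measurable E by apply: open_measurable_rV; exact: open_thickening_open.
apply: (@le_trans _ _ (mu E)); last first.
  apply: ereal_sup_ubound; exists E => //; split=> //.
  exact: open_thickening_sub.
have mB : measurable (~` E) by exact: measurableC.
have AB (x y : 'rV[R]_n) : A x -> (~` E) y -> t ^+ 2 <= sqdist x y.
  by move=> Ax Ey; rewrite leNgt; apply/negP => xy; apply: Ey; exists x.
have prod := mass_product n l M a psi mu l0 M0 psi_convex mu_density psi2
  A (~` E) t mA mB AB.
set p := fine (mu A) in prod; set q := fine (mu (~` E)) in prod.
have pE : mu A = p%:E by rewrite fineK ?fin_num_measure.
have qE : mu (~` E) = q%:E by rewrite fineK ?fin_num_measure.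
have EE : mu E = (1 - q)%:E.
  by rewrite -[E in LHS]setCK probability_setC// qE EFinB.
have p2 : 2^-1 <= p by rewrite -lee_fin -pE.
have q0 : 0 <= q by rewrite -lee_fin -qE.
have pq : p <= 1 - q.
  rewrite -lee_fin -EE -pE; apply: le_measure; rewrite ?inE//.
  by move=> x Ax; exists x => //; rewrite sqdist_xx exprn_gt0.
rewrite EE lee_fin lerD2l lerN2.
(* The claim is squared so that [q ^+ 2 <= p * q] applies; this holds since
   [q <= 1 - p <= 1 / 2 <= p]. *)
rewrite -(@ler_pXn2r _ 2) ?nnegrE ?expR_ge0//.
apply: (@le_trans _ _ (p * q)); first by nra.
apply: (le_trans prod).
rewrite -expRM_natl ler_expR.
set k := expR (M * l ^+ 2 / 8).
(* The product bound yields [9 * l ^+ 2 * k] in place of [alpha l M ^+ 2 = 9 * l ^+ 2 * k ^+ 2];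
   since [k >= 1] this is at least as strong. *)
have k1 : 1 <= k by rewrite -expR0 ler_expR divr_ge0// mulr_ge0// sqr_ge0.
have aE : alpha l M = 3 * l * k by [].
rewrite aE mulrN lerN2.
have -> : 4 / 9 * (2 * l ^+ 2 * k)^-1 * t ^+ 2 = 2 * (t ^+ 2 / (9 * l ^+ 2 * k)).
  by field; rewrite !gt_eqF// (lt_le_trans ltr01).
rewrite ler_pM2l// ler_wpM2l ?sqr_ge0//.
have k0 : 0 < k by exact: lt_le_trans ltr01 k1.
rewrite lef_pV2 ?posrE ?exprn_gt0 ?mulr_gt0 ?exprn_gt0//.
rewrite (_ : (3 * l * k) ^+ 2 = 9 * l ^+ 2 * k * k); last by ring.
by rewrite ler_peMr// mulr_ge0 ?(ltW k0)// mulr_ge0// sqr_ge0.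
Qed.
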